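(* Let $g$ be an odd integer and let $E/\mathbb{Q}$ be the elliptic curve defined by $y^2=x^3-2gx$. For each integer $r\equiv2\ (\mathrm{mod}\ 4)$, the Hardy--Littlewood conjecture (HL) implies $$\pi_{E,r}(x)\sim\frac14\prod_{p\nmid r}\Big(1-\frac{(\frac{-1}{p})}{p-1}\Big)\cdot\frac{\sqrt x}{\log x}.$$
   Context: For $E/\mathbb{Q}$ of conductor $N_E$ and $p\nmid N_E$, $a_p(E)=p+1-|E_p(\mathbb{F}_p)|$, $\pi_{E,r}(x)=|\{p\leqslant x: p\nmid N_E,\ a_p(E)=r\}|$. $(\frac{\cdot}{p})$ is the Legendre symbol; infinite products over primes are in increasing order. (HL): for all $a,b,c\in\mathbb{Z}$ with $a>0$, $b^2-4ac$ not a square, $\gcd(a,b,c)=1$, and $a+b$, $c$ not both even, the number $\pi_{a,b,c}(x)$ of primes $p\leqslant x$ of the form $am^2+bm+c$, $m\in\mathbb{Z}_{\geqslant1}$, satisfies $\pi_{a,b,c}(x)\sim\frac{\gcd(2,a+b)}{\sqrt a}\frac{\Delta}{\varphi(\Delta)}\prod_{p\nmid2a}\Big(1-\frac{(\frac{b^2-4ac}{p})}{p-1}\Big)\frac{\sqrt x}{\log x}$, $\Delta$ being the odd part of $\gcd(a,b)$. *)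

(* Defs.v *)
From HB Require Import structures.
From mathcomp Require Import all_boot all_order all_algebra.
From mathcomp Require Import all_classical all_reals all_analysis.
Set Implicit Arguments.
Unset Strict Implicit.
Unset Printing Implicit Defensive.
Import Order.TTheory GRing.Theory Num.Theory.
Import numFieldNormedType.Exports.
Local Open Scope classical_set_scope.
Local Open Scope ring_scope.

(** y^2 + a1 x y + a3 y = x^3 + a2 x^2 + a4 x + a6 *)
Record weierstrass (K : Type) := Weierstrass { a1 : K; a2 : K; a3 : K; a4 : K; a6 : K }.

HB.instance Definition _ (K : Type) := gen_eqMixin (weierstrass K).
HB.instance Definition _ (K : Type) := gen_choiceMixin (weierstrass K).

Definition map_weierstrass (K L : Type) (f : K -> L) (E : weierstrass K) : weierstrass L :=
  Weierstrass (f (a1 E)) (f (a2 E)) (f (a3 E)) (f (a4 E)) (f (a6 E)).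

Section Weierstrass.
Variable K : comNzRingType.
Implicit Type E : weierstrass K.

Definition disc E : K :=
  let b2 := a1 E ^+ 2 + 4 * a2 E in
  let b4 := 2 * a4 E + a1 E * a3 E in
  let b6 := a3 E ^+ 2 + 4 * a6 E in
  let b8 := a1 E ^+ 2 * a6 E + 4 * a2 E * a6 E - a1 E * a3 E * a4 E
            + a2 E * a3 E ^+ 2 - a4 E ^+ 2 in
  - b2 ^+ 2 * b8 - 8 * b4 ^+ 3 - 27 * b6 ^+ 2 + 9 * b2 * b4 * b6.

Definition on_curve E (x y : K) : bool :=
  y ^+ 2 + a1 E * x * y + a3 E * y == x ^+ 3 + a2 E * x ^+ 2 + a4 E * x + a6 E.

(** E' is obtained from E by the substitution x = u^2 x' + r,
    y = u^3 y' + s u^2 x' + t. *)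
Definition change_vars (u r s t : K) E E' : Prop :=
  [/\ u * a1 E' = a1 E + 2 * s,
      u ^+ 2 * a2 E' = a2 E - s * a1 E + 3 * r - s ^+ 2,
      u ^+ 3 * a3 E' = a3 E + r * a1 E + 2 * t,
      u ^+ 4 * a4 E' = a4 E - s * a3 E + 2 * r * a2 E - (t + r * s) * a1 E
                       + 3 * r ^+ 2 - 2 * s * t
    & u ^+ 6 * a6 E' = a6 E + r * a4 E + r ^+ 2 * a2 E + r ^+ 3 - t * a3 E
                       - t ^+ 2 - r * t * a1 E].
End Weierstrass.

Definition integral_model (E : weierstrass rat) (W : weierstrass int) : Prop :=
  exists u r s t : rat, u != 0 /\ change_vars u r s t E (map_weierstrass intr W).

Definition is_minimal_model (E : weierstrass rat) (W : weierstrass int) : Prop :=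
  integral_model E W /\
  forall W', integral_model E W' -> (`|disc W| <= `|disc W'|)%N.

(** Since Q has class number 1, a global minimal model is minimal at every
    prime; it is unique up to an integral change of variables with u = 1 or
    u = -1, so neither the primes dividing its discriminant nor its reductions
    (up to isomorphism) depend on the choice made by [xget]. *)
Definition minimal_model (E : weierstrass rat) : weierstrass int :=
  xget (Weierstrass 0 0 0 0 0) [set W | is_minimal_model E W].

Lemma integral_model_exists (E : weierstrass rat) : exists W, integral_model E W.
Proof.
case: E => c1 c2 c3 c4 c6.
have clearD (D : int) i (c : rat) : (denq c %| D)%Z ->
    exists n : int, n%:~R = D%:~R ^+ i.+1 * c.
  move=> /dvdzP[k Dk]; exists (D ^+ i * k * numq c).
  have -> : D%:~R ^+ i.+1 = D%:~R ^+ i * (k * denq c)%:~R :> rat.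
    by rewrite exprSr -Dk.
  by rewrite !rmorphM /= rmorphXn /= numqE [c * _]mulrC !mulrA.
pose D : int := denq c1 * denq c2 * denq c3 * denq c4 * denq c6.
have [n1 e1] : exists n : int, n%:~R = D%:~R ^+ 1 * c1.
  by apply: clearD; rewrite /D -!mulrA dvdz_mulr.
have [n2 e2] : exists n : int, n%:~R = D%:~R ^+ 2 * c2.
  by apply: clearD; rewrite /D -!mulrA dvdz_mull // dvdz_mulr.
have [n3 e3] : exists n : int, n%:~R = D%:~R ^+ 3 * c3.
  by apply: clearD; rewrite /D -!mulrA 2?dvdz_mull // dvdz_mulr.
have [n4 e4] : exists n : int, n%:~R = D%:~R ^+ 4 * c4.
  by apply: clearD; rewrite /D -!mulrA 3?dvdz_mull // dvdz_mulr.
have [n6 e6] : exists n : int, n%:~R = D%:~R ^+ 6 * c6.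
  by apply: clearD; rewrite /D dvdz_mull.
have D0 : D%:~R != 0 :> rat by rewrite intr_eq0 !mulf_neq0 ?denq_eq0.
exists (Weierstrass n1 n2 n3 n4 n6), (D%:~R^-1), 0, 0, 0.
split; first by rewrite invr_eq0.
have K i c : D%:~R^-1 ^+ i * (D%:~R ^+ i * c) = c :> rat.
  by rewrite mulrA -exprMn mulVf // expr1n mul1r.
split; rewrite /= ?e1 ?e2 ?e3 ?e4 ?e6 ?K;
  rewrite ?expr0n ?(mulr0, mul0r, addr0, subr0, oppr0) //=.
by rewrite -[X in X * _]expr1 K.
Qed.

Lemma minimal_modelP (E : weierstrass rat) : is_minimal_model E (minimal_model E).
Proof.
have [W0 W0E] := integral_model_exists E.
suff exW : exists W, is_minimal_model E W by apply: xgetPex exW.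
pose P n := `[< exists W, integral_model E W /\ `|disc W|%N = n >].
have exP : exists n, P n by exists `|disc W0|%N; apply/asboolP; exists W0.
case: (ex_minnP exP) => n /asboolP[W [WE Wn]] nmin.
by exists W; split=> // W' W'E; rewrite Wn; apply: nmin; apply/asboolP; exists W'.
Qed.

(** The primes dividing the conductor N_E are exactly those of bad reduction,
    so for a prime p this says that p does not divide N_E. *)
Definition good_reduction (E : weierstrass rat) (p : nat) : bool :=
  ~~ (p %| `|disc (minimal_model E)|)%N.

(** |E_p(F_p)|, the affine points together with the point at infinity;
    meant for p prime. *)
Definition card_reduction (E : weierstrass rat) (p : nat) : nat :=
  let Ep := map_weierstrass (fun n : int => n%:~R : 'F_p) (minimal_model E) in
  #|[pred xy : 'F_p * 'F_p | on_curve Ep xy.1 xy.2]|.+1.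

Definition frobenius_trace (E : weierstrass rat) (p : nat) : int :=
  p%:Z + 1 - (card_reduction E p)%:Z.

Section Counting.
Variable R : realType.

(** f(x) ~ g(x) as x tends to +oo *)
Definition equiv_pinfty (f g : R -> R) : Prop :=
  f x / g x @[x --> +oo%R] --> (1 : R).

(** The number of primes p <= x satisfying P; for x < 0 it is 0 since then
    [truncn x] is 0. *)
Definition prime_count (P : nat -> Prop) (x : R) : nat :=
  #|[pred p : 'I_(Num.truncn x).+1 | prime p && `[< P p >]]|.

(** pi_{E,r}(x) *)
Definition trace_count (E : weierstrass rat) (r : int) (x : R) : nat :=
  prime_count (fun p => good_reduction E p /\ frobenius_trace E p = r) x.

(** pi_{a,b,c}(x) *)
Definition quadratic_count (a b c : int) (x : R) : nat :=
  prime_count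
    (fun p => exists m : int, 1 <= m /\ p%:Z = a * m ^+ 2 + b * m + c) x.

(** Legendre symbol, meant for p an odd prime *)
Definition legendre (n : int) (p : nat) : R :=
  if (p%:Z %| n)%Z then 0
  else if [exists x : 'F_p, x ^+ 2 == n%:~R] then 1 else -1.

(** Infinite product over the primes p satisfying P, in increasing order.
    [limn] is 0 on a divergent sequence, and [equiv_pinfty] to a multiple of 0
    never holds, so an equivalence whose constant is such a product is false
    unless the product converges to a nonzero limit. *)
Definition prime_prod (P : pred nat) (F : nat -> R) : R :=
  limn (fun N : nat => \prod_(0 <= p < N | prime p && P p) F p).

Definition odd_part (n : nat) : nat := (n`_(2^'))%N.

Definition HL_const (a b c : int) : R :=
  let D := odd_part `|gcdz a b| in
  (gcdz 2 (a + b))%:~R / Num.sqrt a%:~R * (D%:R / (totient D)%:R) *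
  prime_prod (fun p => ~~ (p%:Z %| 2 * a)%Z)
             (fun p => 1 - legendre (b ^+ 2 - 4 * a * c) p / (p%:R - 1)).

Definition hardy_littlewood : Prop :=
  forall a b c : int,
    0 < a ->
    ~ (exists k : int, b ^+ 2 - 4 * a * c = k ^+ 2) ->
    gcdz (gcdz a b) c = 1 ->
    ~~ ((2 %| a + b)%Z && (2 %| c)%Z) ->
    equiv_pinfty (fun x => (quadratic_count a b c x)%:R)
                 (fun x => HL_const a b c * (Num.sqrt x / ln x)).

End Counting.

(* Main.v *)
(** For a prime [p = 1 mod 4] let [J] be the Jacobi sum of a quartic and the
    quadratic character of ['F_p]; then [a_p] of [y^2 = x^3 - D x] is
    [-2 Re (conj (chi D) J)], where [|J|^2 = p] and [J = -1 mod (2 + 2i)].  So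
    [a_p = r = 2A] forces [p = A^2 + 4 m^2], and given such an [m], with [chi]
    normalised by [J = +-(A + 2mi)], it amounts to [chi (2g) = +-1] for a sign
    that depends on [A + 2m] modulo 4.  Here [chi 2 = i^(A m)] (Dirichlet) and
    [chi g] is [(-1)^(s m)] times a function of [m] modulo [g] (Gauss sums in
    characteristic [q] for each prime [q] dividing [g]).  Hence exactly one of
    the four lifts modulo [4g] of each class of [m] modulo [g] gives
    [a_p = r].  The constant of (HL) is the same for the four quadratic
    polynomials attached to these lifts, and summing (HL) over all classes must
    reproduce (HL) for [4 m^2 + A^2]; so the count is a quarter of the latter,
    and the Euler factors never need to be computed. *)
Require Import Defs.
From mathcomp Require Import all_boot all_order all_algebra all_solvable all_field.
From mathcomp Require Import all_classical all_reals all_analysis.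
From mathcomp Require Import zify ring.
Import Order.TTheory GRing.Theory Num.Theory.
Import numFieldNormedType.Exports.
Local Open Scope classical_set_scope.
Local Open Scope ring_scope.
Set Implicit Arguments.
Unset Strict Implicit.
Unset Printing Implicit Defensive.

(** * Gauss sums over a prime field *)

(** The quartic character depends on a square root of -1 in ['F_p], yet the final criterion must use
    one function of m for all p. The root taken is f = -A / (2m), that is, reduction modulo the
    prime of Z[i] containing A + 2mi: then J and A + 2mi vanish modulo the same prime, so they
    cannot be conjugate up to a unit, and only a sign remains. Z[i] itself is never built: the
    character is stored as an exponent modulo 4, to be read in ['F_p], in [algC] or in
    characteristic q. There congruences modulo q are equalities and the q-th power is additive,
    which replaces quartic reciprocity; the fourth power of the Gauss sum, (A + 2mi)^2 p, involves
    only m modulo q. Convergence of the infinite product to a nonzero limit is not proved but read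
    off from (HL) for 4 m^2 + A^2. Finitely many primes are discarded, so the minimal model is never
    determined. *)

Section GaussSums.
Variables (p : nat) (p_pr : prime p) (K : fieldType) (z : K).
Hypotheses (zp : z ^+ p = 1) (z1 : z != 1).
Implicit Types (x y s : 'F_p) (a b : 'F_p -> K).

Definition mulchar a := [/\ a 0 = 0, a 1 = 1 & {morph a : x y / x * y}].

Definition addchar x : K := z ^+ x.

Definition gauss a := \sum_x a x * addchar x.

Definition jacobi a b := \sum_x a x * b (1 - x).

Lemma Fp_expr_mod n : z ^+ (n %% (Zp_trunc (pdiv p)).+2) = z ^+ n.
Proof. by rewrite Fp_cast // expr_mod. Qed.

Lemma addcharD : {morph addchar : x y / x + y >-> x * y}.
Proof. by move=> x y; rewrite /addchar /= Fp_expr_mod exprD. Qed.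

Lemma addchar0 : addchar 0 = 1.
Proof. by []. Qed.

Lemma addchar1 : addchar 1 = z.
Proof. by rewrite /addchar /= Fp_expr_mod. Qed.

Lemma addchar_natM n x : addchar (n%:R * x) = addchar x ^+ n.
Proof.
elim: n => [|n IHn]; first by rewrite mul0r.
by rewrite -natr1 mulrDl mul1r addcharD IHn exprSr.
Qed.

Lemma sum_addchar : \sum_x addchar x = 0.
Proof.
suff : (z - 1) * (\sum_x addchar x) = 0.
  by move/eqP; rewrite mulf_eq0 subr_eq0 (negPf z1) => /eqP.
rewrite mulrBl mul1r [X in _ - X](reindex_inj (addrI 1)) mulr_sumr /=.
by apply/eqP; rewrite subr_eq0; apply/eqP/eq_bigr => x _; rewrite addcharD addchar1.
Qed.

Lemma sum_addcharM c : \sum_x addchar (x * c) = if c == 0 then p%:R else 0.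
Proof.
case: eqP => [->|/eqP c0].
  under eq_bigr do rewrite mulr0 addchar0.
  by rewrite sumr_const card_Fp.
by rewrite -[RHS]sum_addchar [RHS](reindex_inj (mulIf c0)).
Qed.

Lemma gaussM a b : mulchar a -> mulchar b -> \sum_x a x * b x = 0 ->
  gauss a * gauss b = jacobi a b * gauss (fun x => a x * b x).
Proof.
move=> [a0 a1 aM] [b0 b1 bM] ab.
(* The pairs with x + y = s: scaling x by s extracts a(s) b(s) and leaves the Jacobi sum, while s =
   0 leaves b(-1) times the sum that vanishes by hypothesis. *)
have conv s : \sum_x a x * b (s - x) = jacobi a b * (a s * b s).
  have [->|s0] := eqVneq s 0.
    rewrite a0 mul0r mulr0.
    under eq_bigr => x _ do rewrite sub0r -mulN1r bM mulrCA.
    by rewrite -mulr_sumr ab mulr0.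
  rewrite (reindex_inj (mulfI s0)) /= mulr_suml; apply: eq_bigr => x _.
  by rewrite -{2}[s]mulr1 -mulrBr aM bM; ring.
rewrite /gauss mulr_suml mulr_sumr.
transitivity (\sum_x \sum_s a x * b (s - x) * addchar s).
  apply: eq_bigr => x _; rewrite mulr_sumr [RHS](reindex_inj (addrI x)) /=.
  by apply: eq_bigr => y _; rewrite addrC addKr addrC addcharD; ring.
rewrite exchange_big /=; apply: eq_bigr => s _.
by rewrite -mulr_suml conv !mulrA.
Qed.

(** Put y = xs: as b inverts a, the product becomes the sum of b(s) against additive sums over
    nonzero x, which are p - 1 at s = -1 and -1 elsewhere; the -1 drops out because b sums to
    zero. *)
Lemma gaussV a b : mulchar a -> mulchar b -> (forall x, x != 0 -> a x * b x = 1) ->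
  \sum_x b x = 0 -> gauss a * gauss b = b (-1) * p%:R.
Proof.
move=> [a0 a1 aM] [b0 b1 bM] ab sb.
transitivity (\sum_x \sum_s (x != 0)%:R * (b s * addchar (x * (1 + s)))).
  rewrite /gauss mulr_suml; apply: eq_bigr => x _.
  have [->|x0] := eqVneq x 0; first by rewrite a0 !mul0r big1 // => s _; rewrite mul0r.
  rewrite mulr_sumr (reindex_inj (mulfI x0)) /=; apply: eq_bigr => s _.
  rewrite mul1r mulrDr mulr1 addcharD bM -[RHS]mul1r -(ab x x0); ring.
rewrite exchange_big /=.
transitivity (\sum_s b s * ((if 1 + s == 0 then p%:R else 0) - 1)).
  apply: eq_bigr => s _; rewrite -sum_addcharM.
  rewrite [\sum_x addchar _](bigD1 0) //= mul0r addchar0 addrC addrK mulr_sumr.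
  rewrite [LHS](bigD1 0) //= ?eqxx mul0r add0r; apply: eq_bigr => x x0.
  by rewrite x0 mul1r.
under eq_bigr do rewrite mulrBr mulr1.
rewrite sumrB sb subr0 (bigD1 (-1)) //= subrr eqxx big1 ?addr0 // => s sN1.
by rewrite addrC addr_eq0 (negPf sN1) mulr0.
Qed.

End GaussSums.

Lemma mulchar_sum0 (p : nat) (p_pr : prime p) (K : fieldType) (a : 'F_p -> K) y :
  mulchar a -> y != 0 -> a y != 1 -> \sum_x a x = 0.
Proof.
move=> [a0 a1 aM] y0 ay; suff : (a y - 1) * (\sum_x a x) = 0.
  by move/eqP; rewrite mulf_eq0 subr_eq0 (negPf ay) => /eqP.
rewrite mulrBl mul1r [X in _ - X](reindex_inj (mulfI y0)) mulr_sumr /=.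
by apply/eqP; rewrite subr_eq0; apply/eqP/eq_bigr => x _; rewrite aM.
Qed.

Lemma prim_root4 (K : fieldType) (i : K) : i ^+ 2 = -1 -> 2%:R != 0 :> K ->
  4.-primitive_root i.
Proof.
move=> i2 n2.
have N11 : (-1 == 1 :> K) = false.
  by apply/negbTE; rewrite eq_sym -subr_eq0 opprK.
have i1 : (i == 1) = false by apply/eqP=> e; move: N11; rewrite -i2 e expr1n eqxx.
have iN1 : (- i == 1) = false.
  by apply/eqP=> e; move: N11; rewrite -i2 -sqrrN e expr1n eqxx.
have i3 : i ^+ 3 = - i by rewrite exprS i2 mulrN1.
have i4 : i ^+ 4 = 1 by rewrite exprS i3 mulrN -expr2 i2 opprK.
apply/andP; split=> //; apply/forallP => -[[|[|[|[|//]]]] lt4] /=;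
  by rewrite unity_rootE ?expr1 ?i2 ?i3 ?i4 ?i1 ?N11 ?iN1 ?eqxx.
Qed.

(** * Euler's criterion and power sums over a prime field *)

Section PrimeField.
Variables (p : nat) (p_pr : prime p) (p_odd : odd p).
Implicit Types x y z : 'F_p.

Lemma Fp2_neq0 : 2%:R != 0 :> 'F_p.
Proof.
rewrite -(dvdn_pcharf (pchar_Fp p_pr)) dvdn_prime2 //.
by apply/eqP=> e; move: p_odd; rewrite e.
Qed.

Lemma Fp_expf1 x : x != 0 -> x ^+ p.-1 = 1.
Proof.
move=> x0; apply: (mulfI x0); rewrite -exprS prednK ?prime_gt0 // mulr1.
by rewrite -{2}(expf_card x) card_Fp.
Qed.

Lemma Fp_prim_root : {w : 'F_p | p.-1.-primitive_root w}.
Proof.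
apply/sigW; have p1 : (0 < p.-1)%N by rewrite -ltnS prednK ?prime_gt0 ?prime_gt1.
have : has p.-1.-primitive_root (enum (predC1 (0 : 'F_p))).
  apply: has_prim_root => //.
  - apply/allP=> x; rewrite mem_enum => x0.
    by apply/unity_rootP; apply: Fp_expf1.
  - by rewrite enum_uniq.
  - by rewrite -cardE cardC1 card_Fp.
by case/hasP=> w _ hw; exists w.
Qed.

Lemma half_prime : p.-1 = (p.-1)./2.*2.
Proof. by case: p p_odd => //= q; rewrite -[in LHS](odd_double_half q) => /negPf->. Qed.

(** Integer-valued and given by Euler's criterion, so that its multiplicativity is that of powers
    and it maps into any field. The real-valued [legendre] enters only in the constants of (HL). *)
Definition leg x : int :=
  if x == 0 then 0 else if x ^+ (p.-1)./2 == 1 then 1 else -1.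

Lemma Euler_criterion x : x != 0 -> reflect (exists y, y ^+ 2 = x) (x ^+ (p.-1)./2 == 1).
Proof.
move=> x0; apply: (iffP eqP) => [e|[y e]].
  have [w hw] := Fp_prim_root; have [i xi] := prim_rootP hw (Fp_expf1 x0).
  move: e; rewrite xi -exprM => /eqP; rewrite -(prim_order_dvd hw) {1}half_prime.
  rewrite -muln2 mulnC dvdn_pmul2r; last by have := prime_gt1 p_pr; have := half_prime; lia.
  by case/dvdnP=> j ->; exists (w ^+ j); rewrite -exprM.
have y0 : y != 0 by apply: contraNneq x0 => y0; rewrite -e y0 expr0n.
by rewrite -e -exprM mul2n -half_prime Fp_expf1.
Qed.

Lemma exp_half x : x != 0 -> x ^+ (p.-1)./2 = 1 \/ x ^+ (p.-1)./2 = -1.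
Proof.
move=> x0; have : (x ^+ (p.-1)./2) ^+ 2 == 1.
  by rewrite -exprM muln2 -half_prime Fp_expf1.
by rewrite sqrf_eq1 => /orP[]/eqP; [left|right].
Qed.

Lemma FpN11 : (-1 == 1 :> 'F_p) = false.
Proof. by apply/negbTE; rewrite eq_sym -subr_eq0 opprK Fp2_neq0. Qed.

Lemma legE x : (leg x)%:~R = x ^+ (p.-1)./2.
Proof.
rewrite /leg; case: eqP => [->|/eqP x0].
  rewrite expr0n; case: eqP => // h.
  by have := prime_gt1 p_pr; have := half_prime; lia.
by have [->|->] := exp_half x0; rewrite ?FpN11 ?eqxx.
Qed.

Lemma legM : {morph leg : x y / x * y}.
Proof.
move=> x y; rewrite /leg mulf_eq0.
case: eqP => [_|/eqP x0] /=; first by rewrite mul0r.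
case: eqP => [_|/eqP y0] /=; first by rewrite mulr0.
rewrite exprMn; have [->|->] := exp_half x0; have [->|->] := exp_half y0;
  by rewrite ?(mulr1, mul1r, mulrN, opprK, FpN11, eqxx).
Qed.

Lemma leg_cases x : x != 0 -> leg x = 1 \/ leg x = -1.
Proof. by rewrite /leg => /negPf->; case: ifP; [left|right]. Qed.

Lemma leg_sqr x : x != 0 -> leg (x ^+ 2) = 1.
Proof. by move=> x0; rewrite expr2 legM; case: (leg_cases x0) => ->. Qed.

Lemma card_sqrt x : #|[pred y : 'F_p | y ^+ 2 == x]|%:Z = 1 + leg x.
Proof.
rewrite /leg; case: eqP => [->|/eqP x0].
  rewrite (eq_card (B := pred1 0)) ?card1 // => y.
  by rewrite !inE expf_eq0.
case: Euler_criterion => // [[y yx]|H].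
  rewrite (eq_card (B := pred2 y (- y))) ?card2.
    suff -> : y != - y by [].
    rewrite -subr_eq0 opprK -mulr2n -mulr_natl mulf_neq0 ?Fp2_neq0 //.
    by apply: contraNneq x0 => y0; rewrite -yx y0 expr0n.
  by move=> t; rewrite !inE -yx eqf_sqr.
rewrite eq_card0 ?subrr // => y; rewrite !inE; apply/negbTE/eqP => e.
by apply: H; exists y.
Qed.

Lemma sum_sqr (F : 'F_p -> int) : \sum_y F (y ^+ 2) = \sum_x (1 + leg x) * F x.
Proof.
rewrite (partition_big (fun y => y ^+ 2) predT) //=; apply: eq_bigr => x _.
rewrite -card_sqrt (eq_bigr (fun=> F x)); last by move=> y /eqP->.
by rewrite sumr_const -mulr_natl natz.
Qed.

Lemma sum_leg : \sum_x leg x = 0.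
Proof.
have := sum_sqr (fun=> 1); under [in RHS]eq_bigr do rewrite mulr1.
by rewrite big_split /= => /eqP; rewrite -subr_eq0 opprD addNKr oppr_eq0 => /eqP.
Qed.

Lemma Fp_sum_expr j : (j < p.-1)%N -> \sum_(x : 'F_p) x ^+ j = 0.
Proof.
move=> ltj; case: j ltj => [|j] ltj.
  by under eq_bigr do rewrite expr0; rewrite sumr_const card_Fp // pchar_Fp_0.
have [w hw] := Fp_prim_root.
apply: (@mulchar_sum0 p p_pr _ (fun x => x ^+ j.+1) w).
- by split=> [||x y]; rewrite ?expr0n ?expr1n ?exprMn.
- by apply: contraTneq hw => ->; rewrite /primitive_root_of_unity;
    apply/negP => /prim_expr_order /eqP;
    rewrite expr0n; case: p.-1 ltj => //= n _; rewrite eq_sym oner_eq0.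
- by rewrite -(prim_order_dvd hw) gtnNdvd.
Qed.

Lemma Fp_sum_horner (P : {poly 'F_p}) : (size P <= p.-1)%N -> \sum_x P.[x] = 0.
Proof.
move=> sP; under eq_bigr do rewrite (horner_coef_wide _ sP).
rewrite exchange_big big1 //= => j _.
by rewrite -mulr_sumr Fp_sum_expr ?mulr0.
Qed.

End PrimeField.

(** * The quartic character and its Jacobi sum *)

Section QuarticCharacter.
Variables (p : nat) (p_pr : prime p) (p4 : (p %% 4)%N = 1%N) (f : 'F_p) (f2 : f ^+ 2 = -1).
Implicit Types x y : 'F_p.

Lemma mod4_odd : odd p.
Proof. by rewrite (divn_eq p 4) p4 oddD oddM andbF. Qed.

Lemma predn_mod4 : p.-1 = (p %/ 4 * 4)%N.
Proof. by rewrite {1}(divn_eq p 4) p4 addn1. Qed.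

Lemma half_predn_mod4 : (p.-1)./2 = (p %/ 4 * 2)%N.
Proof. by have := predn_mod4; lia. Qed.

Lemma divn4_gt0 : (0 < p %/ 4)%N.
Proof. by have := prime_gt1 p_pr; have := p4; lia. Qed.

Lemma root4_Fp : 4.-primitive_root f.
Proof. exact: prim_root4 f2 (Fp2_neq0 p_pr mod4_odd). Qed.

(** The exponent e with f^e = x^((p-1)/4), as [p %/ 4] is (p-1)/4 here; at 0 the value 3 is
    meaningless. A bare exponent can be read in every field with a square root of -1. *)
Definition qlog x : nat :=
  let u := x ^+ (p %/ 4) in
  if u == 1 then 0 else if u == f then 1 else if u == -1 then 2 else 3.

Lemma qlogK x : x != 0 -> f ^+ qlog x = x ^+ (p %/ 4).
Proof.
move=> x0; have /(prim_rootP root4_Fp)[i xi] : (x ^+ (p %/ 4)) ^+ 4 = 1.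
  by rewrite -exprM -predn_mod4 Fp_expf1.
rewrite /qlog; case: eqP => [->//|]; case: eqP => [->//|]; case: eqP => [->//|].
rewrite xi; case: i {xi} => [[|[|[|[|//]]]] _] //=.
Qed.

Lemma qlog_eqmod x n : x != 0 -> f ^+ n = x ^+ (p %/ 4) -> qlog x = n %[mod 4].
Proof.
by move=> x0 e; apply/eqP; rewrite -(eq_prim_root_expr root4_Fp) qlogK // e.
Qed.

Lemma qlogM x y : x != 0 -> y != 0 -> qlog (x * y) = qlog x + qlog y %[mod 4].
Proof.
by move=> x0 y0; apply: qlog_eqmod; rewrite ?mulf_neq0 // exprD !qlogK // exprMn.
Qed.

Lemma qlog1 : qlog 1 = 0.
Proof. by rewrite /qlog expr1n eqxx. Qed.

Lemma leg_qlog x : x != 0 -> leg x = (-1) ^+ qlog x.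
Proof.
move=> x0; rewrite /leg (negPf x0) half_predn_mod4 exprM -qlogK // exprAC f2.
rewrite -(signr_odd 'F_p (qlog x)) -(signr_odd int (qlog x)).
by case: odd; rewrite ?expr1 ?expr0 ?eqxx // (FpN11 p_pr mod4_odd).
Qed.

(** Real and imaginary parts of the quartic character as integers, so that J becomes the pair [jre],
    [jim]. *)
Definition qre x : int := if x == 0 then 0 else nth 0 [:: 1; 0; -1; 0] (qlog x).

Definition qim x : int := if x == 0 then 0 else nth 0 [:: 0; 1; 0; -1] (qlog x).

Lemma qlog_lt4 x : (qlog x < 4)%N.
Proof. by rewrite /qlog; do !case: ifP. Qed.

Lemma qreimM x y : qre (x * y) = qre x * qre y - qim x * qim y /\
  qim (x * y) = qre x * qim y + qim x * qre y.
Proof.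
rewrite /qre /qim mulf_eq0.
case: eqP => [_|/eqP x0] /=; first by rewrite !mul0r.
case: eqP => [_|/eqP y0] /=; first by rewrite !mulr0.
have := qlogM x0 y0; have := qlog_lt4 x; have := qlog_lt4 y; have := qlog_lt4 (x * y).
case: (qlog x) => [|[|[|[|?]]]]; case: (qlog y) => [|[|[|[|?]]]];
  case: (qlog (x * y)) => [|[|[|[|?]]]] h1 h2 h3 h4;
  by [discriminate h1 | discriminate h2 | discriminate h3 | discriminate h4 | split].
Qed.

Lemma leg_reim x : leg x = qre x ^+ 2 - qim x ^+ 2.
Proof.
have [->|x0] := eqVneq x 0; first by rewrite /leg /qre /qim eqxx.
rewrite leg_qlog // /qre /qim (negPf x0).
by have := qlog_lt4 x; case: (qlog x) => [|[|[|[|//]]]].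
Qed.

Definition jre : int := \sum_x qre x * leg (1 - x).

Definition jim : int := \sum_x qim x * leg (1 - x).

Section Values.
Variables (K : fieldType) (i : K) (i2 : i ^+ 2 = -1).

Definition qchar x : K := if x == 0 then 0 else i ^+ qlog x.

Lemma root4_exp : i ^+ 4 = 1.
Proof. by rewrite (exprM i 2 2) i2 sqrrN expr1n. Qed.

Lemma qchar0 : qchar 0 = 0.
Proof. by rewrite /qchar eqxx. Qed.

Lemma qchar1 : qchar 1 = 1.
Proof. by rewrite /qchar oner_eq0 qlog1. Qed.

Lemma qcharM : {morph qchar : x y / x * y}.
Proof.
move=> x y; rewrite /qchar mulf_eq0.
case: eqP => [_|/eqP x0] /=; first by rewrite mul0r.
case: eqP => [_|/eqP y0] /=; first by rewrite mulr0.
by rewrite -exprD -(expr_mod _ root4_exp) qlogM // expr_mod ?root4_exp.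
Qed.

Lemma mulchar_qcharX j : (0 < j)%N -> mulchar (fun x => qchar x ^+ j).
Proof.
move=> j0; split=> [||x y]; rewrite ?qchar0 ?qchar1 ?qcharM ?exprMn ?expr1n //.
by rewrite expr0n eqn0Ngt j0.
Qed.

Lemma qchar_reim x : qchar x = (qre x)%:~R + (qim x)%:~R * i.
Proof.
rewrite /qchar /qre /qim; case: eqP => [_|_]; first by rewrite mul0r addr0.
have := qlog_lt4 x; case: (qlog x) => [|[|[|[|//]]]] _ /=;
  rewrite ?mul0r ?addr0 ?add0r ?mul1r ?expr0 ?expr1 ?i2 ?rmorphN1 ?mulN1r //.
by rewrite exprS i2 mulrN1.
Qed.

Lemma qchar_sqr x : qchar x ^+ 2 = (leg x)%:~R.
Proof.
have [->|x0] := eqVneq x 0; first by rewrite qchar0 expr0n /leg eqxx.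
by rewrite /qchar (negPf x0) leg_qlog // exprAC i2 rmorphXn rmorphN1.
Qed.

Lemma qchar_exp4 x : x != 0 -> qchar x ^+ 4 = 1.
Proof. by move=> x0; rewrite /qchar (negPf x0) exprAC root4_exp expr1n. Qed.

Lemma qcharX_mod4 x j : (0 < j)%N -> qchar x ^+ (j + 4) = qchar x ^+ j.
Proof.
move=> j0; have [->|x0] := eqVneq x 0; first by case: j j0 => // j _; rewrite qchar0 !expr0n.
by rewrite exprD qchar_exp4 // mulr1.
Qed.

Definition jac : K := jacobi (fun x => qchar x ^+ 1) (fun x => qchar x ^+ 2).

Lemma jacE : jac = jre%:~R + jim%:~R * i.
Proof.
rewrite /jac /jacobi /jre /jim !rmorph_sum mulr_suml -big_split /=.
by apply: eq_bigr => x _; rewrite qchar_sqr expr1 qchar_reim !rmorphM /=; ring.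
Qed.

Hypotheses (K2 : 2%:R != 0 :> K).

Lemma root4_K : 4.-primitive_root i.
Proof. exact: prim_root4 i2 K2. Qed.

Lemma qchar_sum0 j : (0 < j < 4)%N -> \sum_x qchar x ^+ j = 0.
Proof.
case/andP=> j0 j4.
have [w hw] := Fp_prim_root p_pr.
have p1 : (0 < p.-1)%N by rewrite -ltnS prednK ?prime_gt0 ?prime_gt1.
have w0 : w != 0.
  apply/eqP=> w0; move/eqP: (prim_expr_order hw).
  by rewrite w0 expr0n eqn0Ngt p1 eq_sym oner_eq0.
apply: (mulchar_sum0 p_pr (mulchar_qcharX j0) w0).
rewrite /qchar (negPf w0) -exprM -(prim_order_dvd root4_K) (prim_order_dvd root4_Fp).
rewrite exprM qlogK // -exprM -(prim_order_dvd hw) predn_mod4.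
by rewrite dvdn_pmul2l ?divn4_gt0 // gtnNdvd.
Qed.

Lemma qcharN1_sqr : qchar (-1) ^+ 2 = 1.
Proof. by rewrite expr2 -qcharM mulrNN mulr1 qchar1. Qed.

Variables (z : K) (zp : z ^+ p = 1) (z1 : z != 1) (Kp : p%:R != 0 :> K).

Definition gs j := gauss z (fun x => qchar x ^+ j).

Lemma eq_gauss (a b : 'F_p -> K) : a =1 b -> gauss z a = gauss z b.
Proof. by move=> e; apply: eq_bigr => x _; rewrite e. Qed.

Lemma gs13 : gs 1 * gs 3 = qchar (-1) * p%:R.
Proof.
rewrite /gs (gaussV p_pr zp z1 (mulchar_qcharX _) (mulchar_qcharX _)) //.
- by rewrite exprS qcharN1_sqr mulr1.
- by move=> x x0; rewrite -exprD qchar_exp4.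
- by rewrite qchar_sum0.
Qed.

Lemma gs22 : gs 2 * gs 2 = p%:R.
Proof.
rewrite /gs (gaussV p_pr zp z1 (mulchar_qcharX _) (mulchar_qcharX _)) //.
- by rewrite qcharN1_sqr mul1r.
- by move=> x x0; rewrite -exprD qchar_exp4.
- by rewrite qchar_sum0.
Qed.

Lemma gs12 : gs 1 * gs 2 = jac * gs 3.
Proof.
rewrite /gs (gaussM p_pr zp (mulchar_qcharX _) (mulchar_qcharX _)) //.
by rewrite -[RHS](@qchar_sum0 3) //; apply: eq_bigr => x _; rewrite -exprD.
Qed.

Lemma gs32 : gs 3 * gs 2 = jacobi (fun x => qchar x ^+ 3) (fun x => qchar x ^+ 2) * gs 1.
Proof.
rewrite /gs (gaussM p_pr zp (mulchar_qcharX _) (mulchar_qcharX _)) //; last first.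
  by rewrite -[RHS](@qchar_sum0 1) //; apply: eq_bigr => x _; rewrite -exprD (@qcharX_mod4 _ 1).
by congr (_ * _); apply: eq_gauss => x; rewrite -exprD (@qcharX_mod4 _ 1).
Qed.

(** (g1 g2 g1)^2 is g1^4 p because g2^2 = p; on the other hand g1 g2 = J g3 and g3 g1 = chi(-1) p
    make it J^2 p^2, the sign chi(-1) being squared away. *)
Lemma gs1_exp4 : gs 1 ^+ 4 = jac ^+ 2 * p%:R.
Proof.
apply: (mulIf Kp).
transitivity ((gs 1 * gs 2 * gs 1) ^+ 2); first by rewrite -{1}gs22; ring.
rewrite gs12 -mulrA [gs 3 * _]mulrC gs13 mulrA !exprMn qcharN1_sqr; ring.
Qed.

Lemma jacobi3E : jacobi (fun x => qchar x ^+ 3) (fun x => qchar x ^+ 2) =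
  jre%:~R - jim%:~R * i.
Proof.
rewrite /jacobi /jre /jim !rmorph_sum mulr_suml -sumrB /=.
apply: eq_bigr => x _; rewrite qchar_sqr exprS qchar_sqr (leg_reim x) qchar_reim.
rewrite !rmorphM rmorphB !rmorphXn /= /qre /qim; case: eqP => [_|_].
  by rewrite rmorph0; ring.
by have := qlog_lt4 x; case: (qlog x) => [|[|[|[|//]]]] _ /=;
  rewrite ?rmorphN1 ?rmorph0 ?rmorph1; ring.
Qed.

(** The product g1 g2 g3 g2 is p g1 g3, since g2^2 = p, and also J times its conjugate times g3 g1;
    cancel g1 g3. *)
Lemma jac_norm_K : (jre ^+ 2 + jim ^+ 2)%:~R = p%:R :> K.
Proof.
have g13 : gs 1 * gs 3 != 0.
  rewrite gs13 mulf_neq0 // -sqrf_eq0 qcharN1_sqr oner_eq0 //.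
apply: (mulIf g13).
rewrite -gs22 [RHS](_ : _ = (gs 1 * gs 2) * (gs 3 * gs 2)); last by ring.
rewrite gs12 gs32 jacobi3E jacE rmorphD !rmorphXn /=.
rewrite [RHS](_ : _ = (jre%:~R ^+ 2 - jim%:~R ^+ 2 * i ^+ 2) * (gs 1 * gs 3)); last by ring.
by rewrite i2; ring.
Qed.

End Values.

End QuarticCharacter.

(** * Norm, reduction modulo p and 2-adic congruence of the Jacobi sum *)

Section JacobiSum.
Variables (p : nat) (p_pr : prime p) (p4 : (p %% 4)%N = 1%N) (f : 'F_p) (f2 : f ^+ 2 = -1).

Lemma jac_norm : jre f ^+ 2 + jim f ^+ 2 = p%:Z.
Proof.
have [z hz] := C_prim_root_exists (prime_gt0 p_pr).
have z1 : z != 1.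
  apply/eqP=> z1; have := prim_order_dvd hz 1; rewrite z1 expr1n eqxx dvdn1.
  by move/eqP=> p1; move: p_pr; rewrite p1.
apply: (mulrIz (oner_neq0 algC)); rewrite -pmulrn.
apply: (jac_norm_K (K := algC) p_pr p4 f2 (@sqrCi algC) _ (prim_expr_order hz) z1);
  by rewrite pnatr_eq0 -?lt0n ?prime_gt0.
Qed.

Lemma sum_qreim : \sum_x qre f x = 0 /\ \sum_x qim f x = 0.
Proof.
have := qchar_sum0 p_pr p4 f2 (@sqrCi algC) _ (isT : (0 < 1 < 4)%N).
rewrite pnatr_eq0 => /(_ isT).
under eq_bigr do rewrite expr1 (qchar_reim _ (@sqrCi algC)).
rewrite big_split /= -mulr_suml -!rmorph_sum /=.
set a := \sum_x _; set b := \sum_x _ => ab.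
have : a ^+ 2 + b ^+ 2 = 0.
  apply: (mulrIz (oner_neq0 algC)); rewrite rmorphD !rmorphXn /= mulr0z.
  transitivity ((a%:~R + b%:~R * 'i) * (a%:~R - b%:~R * 'i) : algC); last by rewrite ab mul0r.
  by rewrite mulrC -subr_sqr exprMn sqrCi; ring.
move/eqP; rewrite paddr_eq0 ?sqr_ge0 // !sqrf_eq0 => /andP[/eqP a0 /eqP b0].
by split.
Qed.

(** Where i becomes f, chi(x) is x^((p-1)/4) and the quadratic character is x^((p-1)/2), so J
    becomes the sum over the field of a polynomial of degree 3(p-1)/4 < p - 1, which is 0. *)
Lemma jac_Fp : (jre f)%:~R + (jim f)%:~R * f = 0.
Proof.
have e x j : (0 < j)%N -> qchar f f x ^+ j = x ^+ (p %/ 4 * j).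
  move=> j0; rewrite exprM /qchar; case: eqP => [->|/eqP x0]; last by rewrite qlogK.
  by rewrite [in RHS]expr0n eqn0Ngt divn4_gt0.
rewrite -(jacE p_pr p4 f2 f2) /jac /jacobi.
pose P : {poly 'F_p} := 'X^(p %/ 4) * (1 - 'X) ^+ (p %/ 4 * 2).
rewrite -[RHS](@Fp_sum_horner p p_pr P).
  by apply: eq_bigr => x _; rewrite !e // muln1 !hornerE.
apply: leq_trans (size_polyMleq _ _) _; rewrite size_polyXn /=.
have : (size ((1 - 'X : {poly 'F_p}) ^+ (p %/ 4 * 2)) <= (p %/ 4 * 2).+1)%N.
  apply: leq_trans (size_poly_exp_leq _ _) _; rewrite ltnS.
  have -> : size (1 - 'X : {poly 'F_p}) = 2 by rewrite -opprB size_polyN size_XsubC.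
  by rewrite mul1n.
rewrite (predn_mod4 p4); move: (divn4_gt0 p_pr p4) (size _) => k0 n; lia.
Qed.

Lemma dvdz_sum_in (d : int) (F : 'F_p -> int) :
  (forall x, (d %| F x)%Z) -> (d %| \sum_x F x)%Z.
Proof. by move=> dF; apply: rpred_sum => x _; apply: dF. Qed.

Lemma sum_leg1B : \sum_(x : 'F_p) leg (1 - x) = 0.
Proof.
have o := mod4_odd p4.
by rewrite -[RHS](sum_leg p_pr o) [RHS](reindex_inj (subrI 1)).
Qed.

Lemma qlog_reim_sign (x : 'F_p) : x != 0 -> qre f x + qim f x = 1 \/ qre f x + qim f x = -1.
Proof.
rewrite /qre /qim => /negPf->.
by have := qlog_lt4 f x; case: (qlog f x) => [|[|[|[|//]]]] _; [left|left|right|right].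
Qed.

Lemma leg1B (x : 'F_p) : x != 1 -> leg (1 - x) = 1 \/ leg (1 - x) = -1.
Proof. by move=> x1; apply: leg_cases; rewrite subr_eq0 eq_sym. Qed.

Lemma qim1 : qim f 1 = 0.
Proof. by rewrite /qim oner_eq0 qlog1. Qed.

Lemma qre1 : qre f 1 = 1.
Proof. by rewrite /qre oner_eq0 qlog1. Qed.

Lemma leg1 : leg (1 : 'F_p) = 1.
Proof. by rewrite /leg oner_eq0 expr1n eqxx. Qed.

(* [J] is congruent to [-1] modulo [2 + 2i], because [(chi - 1) (rho - 1)] is
   a multiple of [2 + 2i] for [chi] and [rho] of order 4 and 2. *)
Lemma jim_even : (2 %| jim f)%Z.
Proof.
have [_ s0] := sum_qreim.
have -> : jim f = \sum_x qim f x * (leg (1 - x) - 1).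
  under eq_bigr do rewrite mulrBr mulr1.
  by rewrite sumrB s0 subr0.
apply: dvdz_sum_in => x; have [->|x1] := eqVneq x 1; first by rewrite qim1 mul0r dvdz0.
by apply: dvdz_mull; case: (leg1B x1) => ->.
Qed.

Lemma jac_mod4 : (4 %| jre f + jim f + 1)%Z.
Proof.
have [r0 i0] := sum_qreim.
(* The sums of chi and of the shifted Legendre symbol vanish, and the p constant terms give p,
   congruent to 1. Off x = 0 and x = 1, where the term is 0, both factors are even. *)
have e : jre f + jim f + p%:Z = \sum_x (qre f x + qim f x - 1) * (leg (1 - x) - 1).
  transitivity (\sum_x ((qre f x * leg (1 - x) + qim f x * leg (1 - x)) -
                 (qre f x + qim f x) - leg (1 - x) + 1)).
    rewrite big_split sumrB sumrB !big_split /= r0 i0 sum_leg1B !subr0.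
    by rewrite sumr_const card_Fp // natz.
  by apply: eq_bigr => x _; ring.
have : (4 %| jre f + jim f + p%:Z)%Z.
  rewrite e; apply: dvdz_sum_in => x.
  have [->|x0] := eqVneq x 0; first by rewrite [1 - 0]subr0 leg1 subrr mulr0 dvdz0.
  have [->|x1] := eqVneq x 1; first by rewrite qim1 qre1 addr0 subrr mul0r dvdz0.
  by case: (qlog_reim_sign x0) => ->; case: (leg1B x1) => ->.
by have := p4; lia.
Qed.

End JacobiSum.

(** J and A + 2mi have norm p and both vanish at i = f, so the product of J with the conjugate of A
    + 2mi has norm p^2 and an imaginary part divisible by p. Its real part is odd, hence nonzero, so
    the product is s p with s = 1 or -1, and the congruence modulo 4 ties s to A + 2m. *)
Lemma jac_representation (p : nat) (p_pr : prime p) (A m : int) (f : 'F_p) :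
  p%:Z = A ^+ 2 + 4 * m ^+ 2 -> ~~ (2 %| A)%Z -> f ^+ 2 = -1 ->
  A%:~R + (2 * m)%:~R * f = 0 ->
  exists s : int, [/\ s ^+ 2 = 1, jre f = s * A, jim f = 2 * s * m & (4 %| s * (A + 2 * m) + 1)%Z].
Proof.
move=> pE oA f2 fA.
have p4 : (p %% 4)%N = 1%N.
  have [k Ak] : exists k, A = 2 * k + 1 by exists (divz A 2); move: oA; clear; lia.
  by have : p%:Z = 4 * (k ^+ 2 + k + m ^+ 2) + 1; [rewrite pE Ak; ring|lia].
have := jac_norm p_pr p4 f2; have := jac_Fp p_pr p4 f2.
have := jim_even p_pr p4 f2; have := jac_mod4 p_pr p4 f2.
move: (jre f) (jim f) => a b ab4 b2 abf ab.
have p_int : p%:Z != 0 by have := prime_gt0 p_pr; lia.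
have pd : (p%:Z %| 2 * m * a - A * b)%Z.
  rewrite (dvdz_pcharf (pchar_Fp p_pr)) rmorphB !rmorphM /=.
  have -> : a%:~R = - (b%:~R * f) by apply/eqP; rewrite -addr_eq0 abf.
  have -> : A%:~R = - ((2 * m)%:~R * f) by apply/eqP; rewrite -addr_eq0 fA.
  by rewrite !rmorphM; apply/eqP; ring.
have key : (2 * m * a - A * b) ^+ 2 + (A * a + 2 * m * b) ^+ 2 = p%:Z ^+ 2.
  by transitivity ((a ^+ 2 + b ^+ 2) * (A ^+ 2 + 4 * m ^+ 2)); [ring|rewrite ab -pE expr2].
have oAa : A * a + 2 * m * b != 0.
  have oa : (a %% 2)%Z = 1 by move: ab4 b2; clear; lia.
  have oA' : (A %% 2)%Z = 1 by move: oA; clear; lia.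
  have : ((A * a) %% 2)%Z = 1 by rewrite -modzMm oA' oa.
  by rewrite -mulrA; move: (A * a) (m * b); clear => u v h; lia.
have c0 : 2 * m * a - A * b = 0.
  case/dvdzP: pd key => k -> key.
  have [->|k0] := eqVneq k 0; first by rewrite mul0r.
  have X2 : 0 < (A * a + 2 * m * b) ^+ 2 by rewrite exprn_even_gt0.
  have k2 : 1 <= k ^+ 2 by rewrite -gtz0_ge1 exprn_even_gt0.
  have lt : (k * p%:Z) ^+ 2 < p%:Z ^+ 2 by rewrite -key ltrDl.
  have le : p%:Z ^+ 2 <= k ^+ 2 * p%:Z ^+ 2 by rewrite ler_peMl ?sqr_ge0.
  by move: lt; rewrite exprMn ltNge le.
move: key; rewrite c0 expr0n add0r => /eqP; rewrite eqf_sqr => key.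
have [s s1 sp] : exists2 s : int, s ^+ 2 = 1 & A * a + 2 * m * b = s * p%:Z.
  by case/orP: key => /eqP->; [exists 1|exists (-1)]; rewrite ?mul1r ?mulN1r.
have e : 2 * m * a = A * b by apply/eqP; rewrite -subr_eq0 c0.
have aE : a = s * A.
  apply: (mulfI p_int); transitivity (A * (A * a + 2 * m * b)); last by rewrite sp; ring.
  by rewrite pE; transitivity (A * (A * a) + 2 * m * (2 * m * a)); [|rewrite e]; ring.
have bE : b = 2 * s * m.
  apply: (mulfI p_int); transitivity (2 * m * (A * a + 2 * m * b)); last by rewrite sp; ring.
  by rewrite pE; transitivity (A * (A * b) + 2 * m * (2 * m * b)); [|rewrite -e]; ring.
exists s; split=> //; move: ab4; rewrite aE bE.
by congr (_ %| _)%Z; ring.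
Qed.

(** * The curves y^2 = x^3 - d x *)

Definition cubic_sum (p : nat) (d : 'F_p) : int := \sum_x leg (x ^+ 3 - d * x).

Lemma card_cubic (p : nat) (p_pr : prime p) (p_odd : odd p) (d : 'F_p) :
  #|[pred xy : 'F_p * 'F_p | xy.2 ^+ 2 == xy.1 ^+ 3 - d * xy.1]|%:Z = p%:Z + cubic_sum d.
Proof.
rewrite -sum1_card (eq_bigl (fun xy => xpredT xy.1 && (xy.2 ^+ 2 == xy.1 ^+ 3 - d * xy.1))) //.
rewrite -(pair_big_dep xpredT (fun x y : 'F_p => y ^+ 2 == x ^+ 3 - d * x) (fun _ _ => 1%N)) /=.
rewrite -natz natr_sum.
under eq_bigr => x _ do rewrite sum1dep_card cardsE natz (card_sqrt p_pr p_odd).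
by rewrite big_split /= sumr_const card_Fp // natz.
Qed.

(** The map x to -x changes the sign of every term, as -1 is not a square. *)
Lemma cubic_sum3 (p : nat) (p_pr : prime p) (p3 : (p %% 4)%N = 3%N) (d : 'F_p) :
  cubic_sum d = 0.
Proof.
have p_odd : odd p by lia.
have N1 : leg (-1 : 'F_p) = -1.
  rewrite /leg oppr_eq0 oner_eq0; have -> : (p.-1)./2 = (p %/ 4 * 2).+1 by lia.
  by rewrite exprS mulnC exprM sqrrN !expr1n mulr1 (FpN11 p_pr p_odd).
suff : cubic_sum d = - cubic_sum d by lia.
rewrite {1}/cubic_sum (reindex_inj oppr_inj) /= -sumrN; apply: eq_bigr => x _.
have -> : (- x) ^+ 3 - d * - x = -1 * (x ^+ 3 - d * x) by ring.
by rewrite (legM p_pr p_odd) N1 mulN1r.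
Qed.

(** Since x^3 - dx = x(x^2 - d) and the symbol of x is chi(x^2), the summand depends on u = x^2
    only. Weighting by the number of square roots doubles Re chi(u), which vanishes at nonsquares;
    the scaling u = dv then exposes J. *)
Lemma cubic_sumE (p : nat) (p_pr : prime p) (p4 : (p %% 4)%N = 1%N) (f d : 'F_p) :
  f ^+ 2 = -1 -> d != 0 ->
  cubic_sum d = 2 * leg d * (qre f d * jre f - qim f d * jim f).
Proof.
move=> f2 d0; have p_odd := mod4_odd p4.
have N1 : leg (-1 : 'F_p) = 1.
  by rewrite /leg oppr_eq0 oner_eq0 (half_predn_mod4 p_pr p4) mulnC exprM sqrrN !expr1n.
have qre_sqr x : qre f (x ^+ 2) = leg x.
  by rewrite expr2 (qreimM p_pr p4 f2 x x).1 (leg_reim p_pr p4 f2) !expr2.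
have leg_qre x : (1 + leg x) * qre f x = 2 * qre f x.
  have [->|x0] := eqVneq x 0; first by rewrite /qre eqxx !mulr0.
  rewrite (leg_reim p_pr p4 f2) /qre /qim (negPf x0).
  by have := qlog_lt4 f x; case: (qlog f x) => [|[|[|[|//]]]].
transitivity (\sum_x qre f (x ^+ 2) * leg (x ^+ 2 - d)).
  by apply: eq_bigr => x _; rewrite qre_sqr -(legM p_pr p_odd); congr leg; ring.
rewrite (sum_sqr p_pr p_odd (fun u => qre f u * leg (u - d))).
transitivity (\sum_u 2 * (qre f u * leg (u - d))).
  by apply: eq_bigr => u _; rewrite mulrA leg_qre mulrA.
rewrite (reindex_inj (mulfI d0)) /jre /jim.
rewrite [qre f d * _]mulr_sumr [qim f d * _]mulr_sumr -sumrB mulr_sumr.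
apply: eq_bigr => v _.
transitivity (2 * ((qre f d * qre f v - qim f d * qim f v) * (leg d * leg (1 - v)))).
  2: by move: (qre f d) (qim f d) (qre f v) (qim f v) (leg d) (leg (1 - v)) => *; ring.
congr (_ * (_ * _)); first exact: (qreimM p_pr p4 f2 d v).1.
have -> : d * v - d = -1 * (d * (1 - v)) by ring.
by rewrite (legM p_pr p_odd (-1) _) N1 mul1r (legM p_pr p_odd d _).
Qed.

Lemma root_of_representation (p : nat) (p_pr : prime p) (A m : int) :
  p%:Z = A ^+ 2 + 4 * m ^+ 2 -> ~~ (2 %| A)%Z ->
  [/\ (p %% 4)%N = 1%N, ~~ (p%:Z %| A)%Z, ~~ (p%:Z %| m)%Z &
  exists2 f : 'F_p, f ^+ 2 = -1 & A%:~R + (2 * m)%:~R * f = 0].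
Proof.
move=> pE oA.
have p4 : (p %% 4)%N = 1%N.
  have [k Ak] : exists k, A = 2 * k + 1 by exists (divz A 2); move: oA; clear; lia.
  by have : p%:Z = 4 * (k ^+ 2 + k + m ^+ 2) + 1; [rewrite pE Ak; ring|lia].
have p1 : 1 < p%:Z by have := prime_gt1 p_pr; lia.
(* A nonzero multiple of p has square greater than p, while A^2 and m^2 are at most p. *)
have big k : k != 0 -> p%:Z < (k * p%:Z) ^+ 2.
  move=> k0; rewrite exprMn; apply: lt_le_trans (_ : p%:Z ^+ 2 <= _).
    by rewrite ltr_eXnr.
  by rewrite ler_peMl ?sqr_ge0 // -gtz0_ge1 exprn_even_gt0.
have pA : ~~ (p%:Z %| A)%Z.
  apply/negP=> /dvdzP[k Ak]; have [k0|/big] := eqVneq k 0.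
    by move: oA; rewrite Ak k0 mul0r dvdz0.
  by rewrite -Ak pE ltNge lerDl mulr_ge0 ?sqr_ge0.
have m0 : m != 0.
  apply/eqP=> m0; move: pE; rewrite m0 expr0n mulr0 addr0 => pA2.
  by move/negP: pA; apply; case/primeP: p_pr => _ /(_ `|A|%N);
    rewrite -[p]absz_nat pA2 abszX /= expnS expn1; move=> /(_ (dvdn_mulr _ (dvdnn _))); nia.
have pm : ~~ (p%:Z %| m)%Z.
  apply/negP=> /dvdzP[k mk]; have [k0|/big] := eqVneq k 0.
    by move: m0; rewrite mk k0 mul0r eqxx.
  rewrite -mk; have := sqr_ge0 A; have := sqr_ge0 m; move: pE.
  by move: (A ^+ 2) (m ^+ 2); clear; lia.
split=> //; have m2 : (2 * m)%:~R != 0 :> 'F_p.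
  rewrite rmorphM /= mulf_neq0 ?Fp2_neq0 ?(mod4_odd p4) //.
  by rewrite -(dvdz_pcharf (pchar_Fp p_pr)).
exists (- A%:~R / (2 * m)%:~R); last by rewrite mulrC divfK // subrr.
apply: (mulIf (expf_neq0 2 m2)); rewrite -exprMn divfK // sqrrN mulN1r.
apply/eqP; rewrite -addr_eq0 -!rmorphXn -rmorphD /= exprMn -pE.
by rewrite -(dvdz_pcharf (pchar_Fp p_pr)).
Qed.

Section Representation.
Variables (p : nat) (p_pr : prime p) (A m : int).
Hypotheses (pE : p%:Z = A ^+ 2 + 4 * m ^+ 2) (oA : ~~ (2 %| A)%Z).
Variables (f : 'F_p) (f2 : f ^+ 2 = -1) (fA : A%:~R + (2 * m)%:~R * f = 0).

Lemma representation_mod4 : (p %% 4)%N = 1%N.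
Proof. by case: (root_of_representation p_pr pE oA). Qed.

(** An odd logarithm makes the trace a multiple of 4, unlike 2A; an even one makes it 2A up to a
    sign that involves s, and A + 2m = -s modulo 4. *)
Lemma cubic_sum_eq (d : 'F_p) : d != 0 ->
  - cubic_sum d = 2 * A <-> ((qlog f d)%:Z = A + 2 * m - 1 %[mod 4])%Z.
Proof.
move=> d0; have p4 := representation_mod4.
have [s [s2 ja jb ds]] := jac_representation p_pr pE oA f2 fA.
have {s2} s1 : s = 1 \/ s = -1.
  by move/eqP: s2; rewrite sqrf_eq1 => /orP[]/eqP; [left|right].
rewrite (cubic_sumE p_pr p4 f2 d0) ja jb (leg_qlog p_pr p4 f2 d0) /qre /qim (negPf d0).
have := qlog_lt4 f d; move: s1 ds oA; clear.
by case: (qlog f d) => [|[|[|[|//]]]] [->|->] ds oA _ /=; lia.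
Qed.

End Representation.

(** * Quadratic and quartic symbols of primes p = A^2 + 4 m^2 *)

Lemma closed_field_pchar (q : nat) (q_pr : prime q) :
  exists K : closedFieldType, q \in [pchar K].
Proof.
have [K [h _]] := countable_algebraic_closure 'F_q.
by exists K; apply: (rmorph_pchar h); apply: pchar_Fp.
Qed.

Lemma closed_field_root4 (K : closedFieldType) : exists i : K, i ^+ 2 = -1.
Proof.
have [i e] := solve_monicpoly (nth 0 [:: -1] : nat -> K) (isT : 0 < 2)%N.
by exists i; rewrite e !big_ord_recl big_ord0 /= expr0 mulr1 mul0r !addr0.
Qed.

(** A root of 1 + X + ... + X^(p-1), found by solving for X^(p-1); it is not 1 because p is nonzero
    in K. *)
Lemma closed_field_prime_root (K : closedFieldType) (p : nat) :
  prime p -> p%:R != 0 :> K -> exists2 z : K, z ^+ p = 1 & z != 1.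
Proof.
move=> p_pr p0; have p1 := prime_gt1 p_pr.
have p2 : (0 < p.-1)%N by lia.
have [z ez] := solve_monicpoly (fun=> -1 : K) p2.
have {}ez : \sum_(j < p) z ^+ j = 0.
  have -> : p = p.-1.+1 by lia.
  rewrite big_ord_recr /= ez; rewrite -big_split big1 //= => j _.
  by rewrite mulN1r subrr.
exists z.
  by apply/eqP; rewrite -subr_eq0 subrX1 ez mulr0.
apply: contraNneq p0 => z1; rewrite -[X in _ == X]ez z1.
under eq_bigr do rewrite expr1n.
by rewrite sumr_const card_ord.
Qed.

Lemma pchar_odd2 (K : fieldType) (q : nat) : q \in [pchar K] -> odd q -> 2%:R != 0 :> K.
Proof.
move=> qK q_odd; have q_pr := pcharf_prime qK.
rewrite -(dvdn_pcharf qK) dvdn_prime2 //.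
by apply/eqP=> e; move: q_odd; rewrite e.
Qed.

(** The q-th power is additive in characteristic q and sends z^x to z^(qx); reindexing by qx
    restores the additive character at the cost of a(q)^q. *)
Lemma gauss_Frobenius (p : nat) (p_pr : prime p) (K : fieldType) (z : K) (zp : z ^+ p = 1)
  (q : nat) (qK : q \in [pchar K]) (a : 'F_p -> K) :
  mulchar a -> q%:R != 0 :> 'F_p ->
  a q%:R ^+ q * gauss z a ^+ q = gauss z (fun x => a x ^+ q).
Proof.
move=> [a0 a1 aM] q0.
rewrite -[gauss z a ^+ q](pFrobenius_autE qK) /gauss rmorph_sum mulr_sumr /=.
rewrite [RHS](reindex_inj (mulfI q0)); apply: eq_bigr => x _.
by rewrite pFrobenius_autE exprMn aM exprMn (addchar_natM p_pr zp) mulrA.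
Qed.

Lemma leg_pchar (K : fieldType) (q : nat) (qK : q \in [pchar K]) (q_odd : odd q) (n : nat) :
  (leg (n%:R : 'F_q))%:~R = n%:R ^+ (q.-1)./2 :> K.
Proof.
have q_pr := pcharf_prime qK; apply/eqP; rewrite -subr_eq0 -natrX [X in _ - X]pmulrn -rmorphB /=.
rewrite -(dvdz_pcharf qK) (dvdz_pcharf (pchar_Fp q_pr)) rmorphB /= subr_eq0.
by rewrite (legE q_pr q_odd) -pmulrn natrX.
Qed.

Lemma legN1 (p : nat) (p_pr : prime p) : (p %% 4)%N = 1%N -> leg (-1 : 'F_p) = 1.
Proof.
move=> p4; rewrite /leg oppr_eq0 oner_eq0 (half_predn_mod4 p_pr p4).
by rewrite mulnC exprM sqrrN !expr1n.
Qed.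

Lemma Fp_nat_eq0 (p n : nat) : prime p -> (n%:R == 0 :> 'F_p) = (p %| n)%N.
Proof. by move=> p_pr; rewrite -(dvdn_pcharf (pchar_Fp p_pr)). Qed.

(** As g2^2 = p, Frobenius on the quadratic Gauss sum gives (q/p) p^((q-1)/2) = 1 in characteristic
    q, and the power is (p/q) by Euler. Since q > 2, the two signs stay distinct there. *)
Lemma leg_reciprocity (p q : nat) (p_pr : prime p) (q_pr : prime q) (f : 'F_p) :
  (p %% 4)%N = 1%N -> f ^+ 2 = -1 -> odd q -> p != q ->
  leg (q%:R : 'F_p) = leg (p%:R : 'F_q).
Proof.
move=> p4 f2 q_odd pq.
have q0 : q%:R != 0 :> 'F_p by rewrite Fp_nat_eq0 // dvdn_prime2.
have p0 : p%:R != 0 :> 'F_q by rewrite Fp_nat_eq0 // dvdn_prime2 // eq_sym.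
have [K qK] := closed_field_pchar q_pr.
have K2 := pchar_odd2 qK q_odd.
have Kp : p%:R != 0 :> K by rewrite -(dvdn_pcharf qK) dvdn_prime2 // eq_sym.
have [i i2] := closed_field_root4 K.
have [z zp z1] := closed_field_prime_root p_pr Kp.
have g22 := gs22 p_pr p4 f2 i2 K2 zp z1.
have g0 : gs f i z 2 != 0 by apply: contraNneq Kp => g0; rewrite -g22 g0 mul0r.
have exp_q (x : 'F_p) : (qchar f i x ^+ 2) ^+ q = qchar f i x ^+ 2.
  have [->|x0] := eqVneq x 0; first by rewrite qchar0 expr0n /= expr0n eqn0Ngt prime_gt0.
  rewrite qchar_sqr //; case: (leg_cases x0) => ->; rewrite ?expr1n //.
  by rewrite rmorphN1 -signr_odd q_odd.
have := gauss_Frobenius p_pr zp qK (mulchar_qcharX p_pr p4 f2 i2 (isT : 0 < 2)%N) q0.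
rewrite exp_q (eq_gauss _ exp_q) -/(gs f i z 2) qchar_sqr //.
rewrite -[in gs _ _ _ _ ^+ q](prednK (prime_gt0 q_pr)) exprSr mulrA => e.
have {}e : (leg (q%:R : 'F_p))%:~R * gs f i z 2 ^+ q.-1 = 1 by apply: (mulIf g0); rewrite mul1r.
move: e; rewrite (half_prime q_odd) -mul2n exprM expr2 g22.
move=> e; have {e} : (leg (q%:R : 'F_p) * leg (p%:R : 'F_q) - 1)%:~R = 0 :> K.
  by rewrite rmorphB rmorphM /= (leg_pchar qK q_odd p) e subrr.
move/eqP; rewrite -(dvdz_pcharf qK).
have q2 : (2 < q)%N by move: (prime_gt1 q_pr) q_odd; clear; lia.
by case: (leg_cases q0) => ->; case: (leg_cases p0) => -> //;
  rewrite dvdzE => /(@dvdn_leq q 2 isT); rewrite leqNgt q2.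
Qed.

(** The Jacobi symbol (2/n) for odd n. *)
Definition sgn8 (n : nat) : int := if (n %% 8 \in [:: 1; 7])%N then 1 else -1.

Lemma sgn8M (m n : nat) : odd m -> odd n -> sgn8 (m * n) = sgn8 m * sgn8 n.
Proof.
move=> om on; rewrite /sgn8 -modnMm.
have m8 : (m %% 8 < 8)%N by rewrite ltn_mod.
have n8 : (n %% 8 < 8)%N by rewrite ltn_mod.
have {om} : odd (m %% 8) by lia.
have {on} : odd (n %% 8) by lia.
move: m8 n8; case: (m %% 8)%N => [|[|[|[|[|[|[|[|?]]]]]]]] //;
  by case: (n %% 8)%N => [|[|[|[|[|[|[|[|?]]]]]]]].
Qed.

(** Compute (1 + i)^q in characteristic q twice: as 1 + i^q by Frobenius, and as (1 +
    i)(2i)^((q-1)/2) from (1 + i)^2 = 2i. *)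
Lemma leg2_sgn8 (q : nat) (q_pr : prime q) : odd q -> leg (2%:R : 'F_q) = sgn8 q.
Proof.
move=> q_odd; have [K qK] := closed_field_pchar q_pr.
have K2 := pchar_odd2 qK q_odd.
have [i i2] := closed_field_root4 K.
have i4 := root4_exp i2.
have l2 := leg_pchar qK q_odd 2.
have e : 1 + i ^+ q = (1 + i) * ((leg (2%:R : 'F_q))%:~R * i ^+ (q.-1)./2).
  have <- : (1 + i) ^+ q = 1 + i ^+ q by rewrite -!(pFrobenius_autE qK) rmorphD rmorph1.
  rewrite -[in LHS](prednK (prime_gt0 q_pr)) exprS {1}(half_prime q_odd).
  have i1 : (1 + i) ^+ 2 = 2%:R * i by rewrite sqrrD i2; ring.
  by rewrite -mul2n exprM i1 exprMn l2.
have n1 : 1 - i != 0.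
  apply/eqP=> h; have : (1 - i) * (1 + i) = 2%:R :> K by rewrite -subr_sqr i2; ring.
  by rewrite h mul0r => /esym/eqP; apply/negP.
have n2 : 1 + i != 0.
  apply/eqP=> h; have : (1 - i) * (1 + i) = 2%:R :> K by rewrite -subr_sqr i2; ring.
  by rewrite h mulr0 => /esym/eqP; apply/negP.
have i4n k r : i ^+ (4 * k + r) = i ^+ r by rewrite exprD exprM i4 expr1n mul1r.
have i3 : i ^+ 3 = - i by rewrite exprS i2 mulrN1.
have nx : 2%:R * (1 + i) != 0 by rewrite mulf_neq0.
have ny : 2%:R * (1 - i) != 0 by rewrite mulf_neq0.
have [k qE] : exists k, q = (8 * k + (q %% 8))%N by exists (q %/ 8)%N; clear; lia.
have hE : (q.-1)./2 = (4 * k + ((q %% 8).-1)./2)%N by clear -qE q_odd; lia.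
have iq : i ^+ q = i ^+ (q %% 8).
  by rewrite {1}qE (_ : (8 * k = 4 * (2 * k))%N) ?i4n //; clear; lia.
have ii : i * i = -1 by rewrite -expr2.
have i5 : i ^+ 5 = i by rewrite (i4n 1 1)%N.
have i7 : i ^+ 7 = - i by rewrite (i4n 1 3)%N.
have r8 := ltn_pmod q (isT : 0 < 8)%N.
have o8 : odd (q %% 8) by clear -q_odd; lia.
move/eqP: e; rewrite iq hE i4n /sgn8 -subr_eq0 => /eqP.
case: (leg_cases (Fp2_neq0 q_pr q_odd)) => ->; move: r8 o8;
case: (q %% 8)%N => [|[|[|[|[|[|[|[|?]]]]]]]] //= _ _;
rewrite ?expr0 ?expr1 ?i2 ?i3 ?i5 ?i7 => e //;
exfalso; [move/eqP: ny | move/eqP: nx | move/eqP: nx | move/eqP: ny]; apply; rewrite -[RHS]e.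
- by transitivity (1 - i - (i + i * i)); [rewrite ii|]; ring.
- by ring.
- by ring.
- by transitivity (1 - i - (i + i * i)); [rewrite ii|]; ring.
Qed.

(** Takes the place of reciprocity for Jacobi symbols; it is applied to n = |A| and n = |A + 2m|. *)
Lemma leg_prime_divisors (p : nat) (p_pr : prime p) (p_odd : odd p) (s : nat -> int) (n : nat) :
  s 1 = 1 -> {in odd &, {morph s : a b / (a * b)%N >-> a * b}} -> odd n ->
  (forall q, prime q -> q %| n -> leg (q%:R : 'F_p) = s q)%N ->
  leg (n%:R : 'F_p) = s n.
Proof.
move=> s1 sM; elim/ltn_ind: n => n IHn n_odd hq.
have [n1|n1] := leqP n 1.
  have -> : n = 1%N by case: n n1 n_odd {IHn hq} => [|[]].
  by rewrite s1 leg1.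
have [d nd] := dvdnP (pdiv_dvd n); have q_pr := pdiv_prime n1.
have := n_odd; rewrite {1}nd oddM => /andP[d_odd q_odd].
rewrite nd natrM (legM p_pr p_odd) sM // (hq _ q_pr (pdiv_dvd n)) IHn //.
  have := prime_gt1 q_pr; move: nd d_odd; clear; nia.
by move=> q q_pr' qd; apply: hq => //; rewrite nd dvdn_mulr.
Qed.

(** Here k is (p-1)/4, e the logarithm of 1 + f and n that of 2; the last hypothesis is (1 + f)^2 =
    2f in logarithms. Everything depends only on A modulo 8 and m modulo 4, which leaves sixteen
    cases. *)
Lemma biquadratic_character_2 (A m : int) (k e n : nat) : ~~ (2 %| A)%Z ->
  4 * k%:Z + 1 = A ^+ 2 + 4 * m ^+ 2 -> (-1) ^+ e = sgn8 `|A + 2 * m| ->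
  (n + k = 2 * e %[mod 4])%N -> (n%:Z = A * m %[mod 4])%Z.
Proof.
move=> oA kE se nk.
have [u [a [Aa aE]]] : exists u a : int, A = 8 * u + a /\ (a = 1 \/ a = 3 \/ a = 5 \/ a = 7).
  by exists (divz A 8), (modz A 8); clear -oA; lia.
have [v [b [mb bE]]] : exists v b : int, m = 4 * v + b /\ (b = 0 \/ b = 1 \/ b = 2 \/ b = 3).
  by exists (divz m 4), (modz m 4); clear; lia.
have sE : sgn8 `|A + 2 * m| = if (odd e) then -1 else 1.
  by rewrite -se -signr_odd; case: odd.
have {}sE : odd e = ~~ ((((A + 2 * m) %% 8)%Z == 1) || (((A + 2 * m) %% 8)%Z == 7)).
  move: sE; rewrite /sgn8 !inE.
  have -> : (absz (A + 2 * m)%R %% 8 == 1)%N || (absz (A + 2 * m)%R %% 8 == 7)%N =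
    (((A + 2 * m) %% 8)%Z == 1) || (((A + 2 * m) %% 8)%Z == 7).
    by clear; lia.
  by case: orb; case: odd.
have {}sE : odd e = ~~ (((a + 2 * b) %% 8)%Z \in [:: 1; 7]).
  rewrite sE !inE; congr (~~ (_ || _)); have -> : A + 2 * m = (u + v) * 8 + (a + 2 * b).
  - by rewrite Aa mb; ring.
  - by rewrite modzMDl.
  - by rewrite Aa mb; ring.
  - by rewrite modzMDl.
have {}kE : 4 * k%:Z + 1 =
    16 * (4 * u ^+ 2 + u * a + 4 * v ^+ 2 + 2 * v * b) + a ^+ 2 + 4 * b ^+ 2.
  by rewrite kE Aa mb; ring.
have -> : A * m = (8 * u * v + 2 * u * b + v * a) * 4 + a * b by rewrite Aa mb; ring.
rewrite modzMDl; move: (4 * u ^+ 2 + _ + _ + _) kE => w kE.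
move: kE nk sE; clear -aE bE.
by case: aE => [->|[->|[->|->]]]; case: bE => [->|[->|[->|->]]] kE nk sE;
  rewrite ?inE /= in sE; lia.
Qed.

(** * Quadratic symbols of A and A + 2m, quartic symbols of -1 and 2 *)

Section RepresentedPrime.
Variables (p : nat) (p_pr : prime p) (A m : int).
Hypotheses (pE : p%:Z = A ^+ 2 + 4 * m ^+ 2) (oA : ~~ (2 %| A)%Z).
Variables (f : 'F_p) (f2 : f ^+ 2 = -1) (fA : A%:~R + (2 * m)%:~R * f = 0).

Let p4 : (p %% 4)%N = 1%N := representation_mod4 p_pr pE oA.
Let p_odd : odd p := mod4_odd p4.

Lemma leg_abs (n : int) : leg (n%:~R : 'F_p) = leg (`|n|%N%:R : 'F_p).
Proof.
case: (intP n) => [|k|k] //; rewrite ?abszN absz_nat //.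
by rewrite rmorphN /= -mulN1r (legM p_pr p_odd) (legN1 p_pr p4) mul1r.
Qed.

(** Modulo a prime q dividing A, p = (2m)^2 is a square, and reciprocity has no sign as p = 1 mod
    4. *)
Lemma leg_A : leg (A%:~R : 'F_p) = 1.
Proof.
have [_ pA pm _] := root_of_representation p_pr pE oA.
rewrite leg_abs; apply: (leg_prime_divisors p_pr p_odd (s := fun=> 1)) => //.
  by move: oA; clear; lia.
move=> q q_pr qA.
have q_odd : odd q.
  by apply: dvdn_odd qA _; move: oA; clear; lia.
have pq : p != q by apply: contraNneq pA => ->; rewrite dvdzE.
rewrite (leg_reciprocity p_pr q_pr p4 f2 q_odd pq).
have A0 : A%:~R = 0 :> 'F_q.
  by apply/eqP; rewrite -(dvdz_pcharf (pchar_Fp q_pr)) dvdzE.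
have e : p%:R = (2 * m)%:~R ^+ 2 :> 'F_q.
  have -> : p%:R = (p%:Z)%:~R :> 'F_q by rewrite -pmulrn.
  by rewrite pE rmorphD rmorphXn /= A0 expr0n add0r -rmorphXn /= exprMn.
rewrite e leg_sqr //; apply: contraTneq pq => m0.
have /eqP := e; rewrite m0 expr0n /= Fp_nat_eq0 // dvdn_prime2 //.
by rewrite eq_sym => /eqP->; rewrite eqxx.
Qed.

(** Modulo a prime q dividing A + 2m, 2p = (A + 2m)^2 + (A - 2m)^2 is a square, so (q/p) = (p/q) =
    (2/q). *)
Lemma leg_A2m : leg ((A + 2 * m)%:~R : 'F_p) = sgn8 `|A + 2 * m|.
Proof.
have [_ pA pm _] := root_of_representation p_pr pE oA.
have n_odd : odd `|A + 2 * m| by move: oA; clear; lia.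
rewrite leg_abs; apply: (leg_prime_divisors p_pr p_odd) => //.
  by move=> a b; apply: sgn8M.
move=> q q_pr qn; have q_odd := dvdn_odd qn n_odd.
have n0 : (A + 2 * m)%:~R = 0 :> 'F_q.
  by apply/eqP; rewrite -(dvdz_pcharf (pchar_Fp q_pr)) dvdzE.
have e : 2%:R * p%:R = (A - 2 * m)%:~R ^+ 2 :> 'F_q.
  have -> : p%:R = (p%:Z)%:~R :> 'F_q by rewrite -pmulrn.
  have <- : ((A + 2 * m) ^+ 2 + (A - 2 * m) ^+ 2)%:~R = (A - 2 * m)%:~R ^+ 2 :> 'F_q.
    by rewrite rmorphD rmorphXn /= n0 expr0n add0r rmorphXn.
  by rewrite pE -(rmorph_nat intr) -rmorphM /=; congr _%:~R; ring.
have pq : p != q.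
  apply/eqP=> pq; have p0 : p%:R = 0 :> 'F_q by rewrite pq pchar_Fp_0.
  have /eqP := e; rewrite p0 mulr0 eq_sym expf_eq0 /= => /eqP d0.
  have : (A + 2 * m)%:~R + (A - 2 * m)%:~R = 0 :> 'F_q by rewrite n0 d0 addr0.
  rewrite -rmorphD /= => /eqP; rewrite -(dvdz_pcharf (pchar_Fp q_pr)) -pq => h.
  have : (p%:Z %| 2 * A)%Z by move: h; congr (_ %| _)%Z; ring.
  rewrite Gauss_dvdzr ?(negPf pA) //.
  by rewrite coprimezE /= prime_coprime // dvdn_prime2 //; move: p_odd; clear; lia.
rewrite (leg_reciprocity p_pr q_pr p4 f2 q_odd pq) -(leg2_sgn8 q_pr q_odd).
have p0 : p%:R != 0 :> 'F_q by rewrite Fp_nat_eq0 // dvdn_prime2 // eq_sym.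
have t0 := Fp2_neq0 q_pr q_odd.
have : leg (2%:R * p%:R : 'F_q) = 1.
  by rewrite e leg_sqr //; have := mulf_neq0 t0 p0; rewrite e expf_eq0.
by rewrite (legM q_pr q_odd); case: (leg_cases t0) => ->; case: (leg_cases p0) => ->.
Qed.

Lemma f_neq0 : f != 0.
Proof. by apply: contra_eq_neq f2 => ->; rewrite expr0n eq_sym oppr_eq0 oner_eq0. Qed.

Lemma qlog_f : qlog f f = (p %/ 4)%N %[mod 4].
Proof. by apply: (qlog_eqmod p_pr p4 f2 f_neq0). Qed.

Lemma qlog_sqr (x : 'F_p) : x != 0 -> qlog f (x ^+ 2) = (2 * qlog f x)%N %[mod 4].
Proof. by move=> x0; rewrite expr2 (qlogM p_pr p4 f2) // addnn mul2n. Qed.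

(** With A = 2k + 1, (p-1)/4 = k(k+1) + m^2 has the parity of m, and the logarithm of -1 = f^2 is
    twice (p-1)/4. *)
Lemma qlog_N1 : ((qlog f (-1 : 'F_p)%R)%:Z = 2 * m %[mod 4])%Z.
Proof.
have e : qlog f (-1) = (2 * (p %/ 4))%N %[mod 4].
  by rewrite -f2 qlog_sqr ?f_neq0 // -modnMmr qlog_f modnMmr.
have [k Ak] : exists k, A = 2 * k + 1 by exists (divz A 2); move: oA; clear; lia.
have : p%:Z = 4 * (k * (k + 1) + m ^+ 2) + 1 by rewrite pE Ak; ring.
have [j ->] : exists j, k * (k + 1) = 2 * j.
  have [t [->|->]] : exists t, k = 2 * t \/ k = 2 * t + 1.
  - by exists (divz k 2); clear; lia.
  - by exists (t * (2 * t + 1)); ring.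
  - by exists ((2 * t + 1) * (t + 1)); ring.
have [t [->|->]] : exists t, m = 2 * t \/ m = 2 * t + 1.
- by exists (divz m 2); clear; lia.
- have -> : (2 * t) ^+ 2 = 4 * t ^+ 2 by ring.
  by move: e; move: (qlog _ _) (t ^+ 2); clear; lia.
- have -> : (2 * t + 1) ^+ 2 = 4 * (t ^+ 2 + t) + 1 by ring.
  by move: e; move: (qlog _ _) (t ^+ 2); clear; lia.
Qed.

(** From A + 2mf = 0 comes A(1 + f) = A + 2m, which gives the quadratic symbol of 1 + f; as (1 +
    f)^2 = 2f, this determines the quartic symbol of 2. *)
Lemma qlog_2 : ((qlog f (2%:R)%R)%:Z = A * m %[mod 4])%Z.
Proof.
have [_ pA pm _] := root_of_representation p_pr pE oA.
have A0 : A%:~R != 0 :> 'F_p by rewrite -(dvdz_pcharf (pchar_Fp p_pr)).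
have eA : A%:~R * (1 + f) = (A + 2 * m)%:~R.
  rewrite rmorphD /= mulrDr mulr1; congr (_ + _).
  have -> : A%:~R = - ((2 * m)%:~R * f) by apply/eqP; rewrite -addr_eq0 fA.
  by rewrite mulNr -mulrA -expr2 f2 mulrN1 opprK.
have f1sq : (1 + f) ^+ 2 = 2%:R * f by rewrite sqrrD f2; ring.
have t0 := Fp2_neq0 p_pr p_odd.
have f1 : 1 + f != 0.
  by have := mulf_neq0 t0 f_neq0; rewrite -f1sq expf_eq0.
have l : (-1) ^+ qlog f (1 + f) = sgn8 `|A + 2 * m|.
  by rewrite -(leg_qlog p_pr p4 f2 f1) -leg_A2m -eA (legM p_pr p_odd) leg_A mul1r.
apply: (biquadratic_character_2 (k := (p %/ 4)%N) oA _ l).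
  by rewrite -pE; move: p4; clear; lia.
by rewrite -modnDmr -qlog_f modnDmr -(qlogM p_pr p4 f2 t0 f_neq0) -f1sq qlog_sqr.
Qed.

End RepresentedPrime.

(** * Quartic symbols of odd primes and integers as functions of m *)

Section PrimeSymbol.
Variables (q : nat) (q_pr : prime q) (q_odd : odd q).
Variables (K : fieldType) (qK : q \in [pchar K]) (i : K) (i2 : i ^+ 2 = -1).
Variables (A m : int) (p : nat) (p_pr : prime p).
Hypotheses (pE : p%:Z = A ^+ 2 + 4 * m ^+ 2) (oA : ~~ (2 %| A)%Z).
Variables (f : 'F_p) (f2 : f ^+ 2 = -1) (fA : A%:~R + (2 * m)%:~R * f = 0).
Variables (z : K) (zp : z ^+ p = 1) (z1 : z != 1) (pq : p != q).

(** J^2 p with J = s(A + 2mi), the sign s squared away. Written in A and m alone, it depends in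
    characteristic q only on m modulo q. *)
Definition gauss_pow4 : K :=
  (A%:~R + (2 * m)%:~R * i) ^+ 2 * (A ^+ 2 + 4 * m ^+ 2)%:~R.

Let p4 : (p %% 4)%N = 1%N := representation_mod4 p_pr pE oA.
Let K2 : 2%:R != 0 :> K := pchar_odd2 qK q_odd.

Let q0 : q%:R != 0 :> 'F_p.
Proof. by rewrite Fp_nat_eq0 // dvdn_prime2. Qed.

Let Kp : p%:R != 0 :> K.
Proof. by rewrite -(dvdn_pcharf qK) dvdn_prime2 // eq_sym. Qed.

Let pKE : (A ^+ 2 + 4 * m ^+ 2)%:~R = p%:R :> K.
Proof. by rewrite -pE -pmulrn. Qed.

Lemma gs1_pow4 : gs f i z 1 ^+ 4 = gauss_pow4.
Proof.
have [s [s2 ja jb _]] := jac_representation p_pr pE oA f2 fA.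
rewrite (gs1_exp4 p_pr p4 f2 i2 K2 zp z1 Kp) /gauss_pow4 pKE (jacE p_pr p4 f2 i2) ja jb.
congr (_ * _); transitivity ((s ^+ 2)%:~R * (A%:~R + (2 * m)%:~R * i) ^+ 2 : K).
  by rewrite !rmorphM /=; ring.
by rewrite s2 mul1r.
Qed.

Lemma gs1_neq0 : gs f i z 1 != 0.
Proof.
have := gs13 p_pr p4 f2 i2 K2 zp z1; apply: contra_eq_neq => ->.
by rewrite mul0r eq_sym mulf_neq0 // -sqrf_eq0 (qcharN1_sqr p_pr p4) // oner_eq0.
Qed.

Let frob : qchar f i q%:R ^+ q * gs f i z 1 ^+ q = gauss z (fun x => qchar f i x ^+ q).
Proof.
apply: (gauss_Frobenius p_pr zp qK _ q0).
by split; [exact: qchar0|exact: qchar1|exact: qcharM].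
Qed.

Let qcharXq (r : nat) (x : 'F_p) : (0 < r)%N -> (q %% 4)%N = r ->
  qchar f i x ^+ q = qchar f i x ^+ r.
Proof.
move=> r0 qr; rewrite (divn_eq q 4) qr addnC.
by elim: (q %/ 4)%N => [|n IHn]; rewrite ?addn0 // mulSn addnCA addnC qcharX_mod4 // ltn_addr.
Qed.

Let qcharq : qchar f i q%:R = i ^+ qlog f q%:R.
Proof. by rewrite /qchar (negPf q0). Qed.

(** Now chi^q = chi, and Frobenius leaves chi(q) g1^(q-1) = 1; the factor 3 in the exponent inverts
    chi(q). *)
Lemma quartic_symbol1 : (q %% 4)%N = 1%N ->
  gauss_pow4 ^+ (q %/ 4) = i ^+ (3 * qlog f q%:R).
Proof.
move=> q1; have := frob; rewrite (qcharXq _ (isT : 0 < 1)%N q1) expr1.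
rewrite (eq_gauss _ (fun x => qcharXq x (isT : 0 < 1)%N q1)) -/(gs f i z 1).
rewrite -[in gs _ _ _ _ ^+ q](prednK (prime_gt0 q_pr)) exprSr mulrA => e.
have {}e : qchar f i q%:R * gs f i z 1 ^+ q.-1 = 1.
  by apply: (mulIf gs1_neq0); rewrite mul1r.
move: e; have -> : q.-1 = (4 * (q %/ 4))%N by move: q1; clear; lia.
rewrite exprM gs1_pow4 qcharq => e.
have ie : i ^+ qlog f q%:R != 0 by apply: contra_eq_neq e => ->; rewrite mul0r eq_sym oner_neq0.
apply: (mulfI ie); rewrite e -exprD (_ : _ + _ = 4 * qlog f (q%:R)%R)%N; last by clear; lia.
by rewrite exprM (root4_exp i2) expr1n.
Qed.

(** Now chi^q = chi^3 is the conjugate character; multiplying by g1 brings in g1 g3 = chi(-1) p,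
    whence the logarithm of -1. *)
Lemma quartic_symbol3 : (q %% 4)%N = 3%N ->
  gauss_pow4 ^+ (q %/ 4).+1 / (A ^+ 2 + 4 * m ^+ 2)%:~R =
  i ^+ (qlog f q%:R + qlog f (-1)).
Proof.
move=> q3; have := frob; rewrite (qcharXq _ (isT : 0 < 3)%N q3).
rewrite (eq_gauss _ (fun x => qcharXq x (isT : 0 < 3)%N q3)) -/(gs f i z 3).
move/(congr1 (fun t => gs f i z 1 * t)); rewrite (gs13 p_pr p4 f2 i2 K2 zp z1).
rewrite mulrCA -exprS; have -> : q.+1 = (4 * (q %/ 4).+1)%N by move: q3; clear; lia.
rewrite exprM gs1_pow4 qcharq pKE => e; apply: (mulIf Kp); rewrite divfK //.
have N10 : (-1 == 0 :> 'F_p) = false by rewrite oppr_eq0 oner_eq0.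
rewrite exprD -mulrA; move: e; rewrite /qchar N10 => <-.
by rewrite mulrA -exprS -exprM mulnC exprM (root4_exp i2) expr1n mul1r.
Qed.

End PrimeSymbol.

Lemma qlog_prime_periodic (A : int) (q : nat) (q_pr : prime q) (q_odd : odd q) :
  ~~ (2 %| A)%Z -> exists (s : int) (G : int -> int),
    (forall m m' : int, (m = m' %[mod q%:Z])%Z -> G m = G m') /\
    forall (m : int) (p : nat) (f : 'F_p), prime p -> p%:Z = A ^+ 2 + 4 * m ^+ 2 ->
      f ^+ 2 = -1 -> A%:~R + (2 * m)%:~R * f = 0 -> p != q ->
      ((qlog f (q%:R)%R)%:Z = G m + 2 * s * m %[mod 4])%Z.
Proof.
move=> oA; have [K qK] := closed_field_pchar q_pr.
have K2 := pchar_odd2 qK q_odd.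
have [i i2] := closed_field_root4 K.
(* A logarithm on K fixed before p, f and z, so that the periodic function depends on none of
   them. *)
pose L (h : K) : int := if h == 1 then 0 else if h == i then 1 else if h == -1 then 2 else 3.
have LE n : (L (i ^+ n) = n%:Z %[mod 4])%Z.
  have E := eq_prim_root_expr (root4_K i2 K2) n.
  rewrite /L; have := E 0%N; have := E 1%N; have := E 2%N.
  rewrite expr0 expr1 i2 => -> -> ->; clear.
  by case: eqP => [?|?]; [|case: eqP => [?|?]; [|case: eqP => [?|?]]]; lia.
have periodic m m' : (m = m' %[mod q%:Z])%Z -> gauss_pow4 i A m = gauss_pow4 i A m' /\
    (A ^+ 2 + 4 * m ^+ 2)%:~R = (A ^+ 2 + 4 * m' ^+ 2)%:~R :> K.
  move=> /eqP; rewrite eqz_mod_dvd (dvdz_pcharf qK) rmorphB subr_eq0 /= => /eqP e.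
  by rewrite /gauss_pow4 !(rmorphD, rmorphM, rmorphXn) /= e.
(* For q = 1 mod 4 the symbol is i^(3e), and 3 * 3 = 1 modulo 4 recovers e; for q = 3 mod 4 it is
   i^(e + 2m), hence s = 1. *)
pose H r (m : int) : int := if r == 1%N then 3 * L (gauss_pow4 i A m ^+ (q %/ 4))
   else L (gauss_pow4 i A m ^+ (q %/ 4).+1 / (A ^+ 2 + 4 * m ^+ 2)%:~R).
have q4 : (q %% 4 = 1 \/ q %% 4 = 3)%N by move: q_odd; clear; lia.
exists (if (q %% 4 == 1)%N then 0 else 1), (H (q %% 4)%N).
split=> [m m' /periodic[e1 e2]|m p f p_pr pE f2 fA pq]; first by rewrite /H e1 e2.
have Kp : p%:R != 0 :> K by rewrite -(dvdn_pcharf qK) dvdn_prime2 // eq_sym.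
have [z zp z1] := closed_field_prime_root p_pr Kp.
case: q4 => q4; rewrite /H q4 /=.
  rewrite (quartic_symbol1 q_pr q_odd qK i2 p_pr pE oA f2 fA zp z1 pq q4).
  move: (LE (3 * qlog f (q%:R)%R)%N).
  by move: (L (i ^+ (3 * qlog f q%:R))) => l; clear; lia.
rewrite (quartic_symbol3 q_pr q_odd qK i2 p_pr pE oA f2 fA zp z1 pq q4).
have := LE (qlog f (q%:R)%R + qlog f (-1 : 'F_p)%R)%N; have := qlog_N1 p_pr pE oA f2.
by move: (L (i ^+ (qlog f q%:R + qlog f (-1)))) => l; clear; lia.
Qed.

Lemma qlog_int_periodic (A g : int) : ~~ (2 %| A)%Z -> ~~ (2 %| g)%Z ->
  exists (s : int) (G : int -> int),
    (forall m m' : int, (m = m' %[mod g])%Z -> G m = G m') /\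
    forall (m : int) (p : nat) (f : 'F_p), prime p -> p%:Z = A ^+ 2 + 4 * m ^+ 2 ->
      f ^+ 2 = -1 -> A%:~R + (2 * m)%:~R * f = 0 -> ~~ (p%:Z %| g)%Z ->
      ((qlog f (g%:~R)%R)%:Z = G m + 2 * s * m %[mod 4])%Z.
Proof.
move=> oA og.
have nat_case n : odd n -> exists (s : int) (G : int -> int),
    (forall m m' : int, (m = m' %[mod n%:Z])%Z -> G m = G m') /\
    forall (m : int) (p : nat) (f : 'F_p), prime p -> p%:Z = A ^+ 2 + 4 * m ^+ 2 ->
      f ^+ 2 = -1 -> A%:~R + (2 * m)%:~R * f = 0 -> ~~ (p %| n)%N ->
      ((qlog f (n%:R)%R)%:Z = G m + 2 * s * m %[mod 4])%Z.
  elim/ltn_ind: n => n IHn n_odd; have [n1|n1] := leqP n 1.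
    have -> : n = 1%N by case: n n1 n_odd {IHn} => [|[]].
    exists 0, (fun=> 0); split=> // m p f p_pr pE f2 fA _.
    by rewrite qlog1 mulr0 mul0r.
  have [d nd] := dvdnP (pdiv_dvd n); have q_pr := pdiv_prime n1.
  have := n_odd; rewrite {1}nd oddM => /andP[d_odd q_odd].
  have dn : (d < n)%N by have := prime_gt1 q_pr; move: nd d_odd; clear; nia.
  have [s1 [G1 [G1p H1]]] := IHn d dn d_odd.
  have [s2 [G2 [G2p H2]]] := qlog_prime_periodic q_pr q_odd oA.
  exists (s1 + s2), (fun m => G1 m + G2 m); split=> [m m' /eqP mm'|m p f p_pr pE f2 fA pn].
    rewrite eqz_mod_dvd nd PoszM in mm'.
    by rewrite (G1p m m') ?(G2p m m') //; apply/eqP; rewrite eqz_mod_dvd;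
      [apply: dvdz_trans mm'; rewrite dvdz_mull|apply: dvdz_trans mm'; rewrite dvdz_mulr].
  rewrite nd Euclid_dvdM // negb_or in pn; case/andP: pn => pd pq.
  have := H1 m p f p_pr pE f2 fA pd.
  have := H2 m p f p_pr pE f2 fA; rewrite -dvdn_prime2 // => /(_ pq).
  have := qlogM p_pr (representation_mod4 p_pr pE oA) f2 (x := d%:R) (y := (pdiv n)%:R).
  rewrite !Fp_nat_eq0 // -natrM -nd => /(_ pd pq).
  move: (qlog _ _) (qlog _ _) (qlog _ _) (G1 m) (G2 m); clear => *.
  by rewrite mulrDr mulrDl; lia.
have og' : odd `|g| by move: og; clear; lia.
have [s [G [Gp H]]] := nat_case _ og'.
(* A negative g contributes chi(-1), whose logarithm is 2m: one more unit of s. *)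
exists (s + (if g < 0 then 1 else 0)), G; split=> [m m' /eqP mm'|m p f p_pr pE f2 fA pg].
  by apply: Gp; apply/eqP; move: mm'; rewrite !eqz_mod_dvd !dvdzE.
rewrite dvdzE /= in pg; have h := H m p f p_pr pE f2 fA pg.
have [g0|g0] := ltrP g 0; last first.
  have -> : g%:~R = `|g|%N%:R :> 'F_p by rewrite -{1}(gez0_abs g0) -pmulrn.
  by rewrite addr0.
have -> : g%:~R = -1 * `|g|%N%:R :> 'F_p.
  by rewrite mulN1r [`|g|%N%:R]pmulrn -rmorphN /=; congr _%:~R; clear -g0; lia.
have := qlogM p_pr (representation_mod4 p_pr pE oA) f2 (x := -1) (y := `|g|%N%:R).
rewrite oppr_eq0 oner_eq0 Fp_nat_eq0 // => /(_ isT pg).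
have := qlog_N1 p_pr pE oA f2; move: h.
move: (qlog _ _) (qlog _ _) (qlog _ _) (G m); clear => *.
by rewrite mulrDr mulrDl; lia.
Qed.

(* Writing [e] for the quartic logarithm, the criterion is
   [e 2 + e g = A + 2 m - 1] modulo 4, where [e 2 = A m] and where [e g] is
   [2 s m] plus a function of [m] modulo [g]. *)
Lemma cubic_trace_criterion (A g : int) : ~~ (2 %| A)%Z -> ~~ (2 %| g)%Z ->
  exists (c : int) (G : int -> int), [/\ ~~ (2 %| c)%Z,
    forall m m' : int, (m = m' %[mod g])%Z -> G m = G m' &
    forall (m : int) (p : nat), prime p -> p%:Z = A ^+ 2 + 4 * m ^+ 2 -> ~~ (p%:Z %| g)%Z ->
      - cubic_sum ((2 * g)%:~R : 'F_p) = 2 * A <-> (c * m + G m = A - 1 %[mod 4])%Z].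
Proof.
move=> oA og; have [s [G [Gp H]]] := qlog_int_periodic oA og.
exists (A + 2 * s - 2), G; split=> // [|m p p_pr pE pg]; first by move: oA; clear; lia.
have [p4 pA pm [f f2 fA]] := root_of_representation p_pr pE oA.
have g0 : g%:~R != 0 :> 'F_p by rewrite -(dvdz_pcharf (pchar_Fp p_pr)).
have t0 := Fp2_neq0 p_pr (mod4_odd p4).
have h1 := H m p f p_pr pE f2 fA pg.
have h2 := qlog_2 p_pr pE oA f2 fA.
have h3 := qlogM p_pr p4 f2 t0 g0.
have -> : (2 * g)%:~R = 2%:R * g%:~R :> 'F_p by rewrite rmorphM.
apply: (iff_trans (cubic_sum_eq p_pr pE oA f2 fA (mulf_neq0 t0 g0))).
have -> : (A + 2 * s - 2) * m = A * m + 2 * s * m - 2 * m by ring.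
move: h1 h2 h3; move: (qlog _ _) (qlog _ _) (qlog _ _) (A * m) (2 * s * m) (G m).
by clear => e1 e2 e3 Am sm Gm; lia.
Qed.

(** * Reduction of the minimal model *)

Lemma common_denominator (u r s t : rat) : exists (d U V S T : int),
  [/\ d != 0, u * d%:~R = U%:~R, r * d%:~R = V%:~R, s * d%:~R = S%:~R & t * d%:~R = T%:~R].
Proof.
exists (denq u * denq r * denq s * denq t).
exists (numq u * denq r * denq s * denq t), (denq u * numq r * denq s * denq t).
exists (denq u * denq r * numq s * denq t), (denq u * denq r * denq s * numq t).
split; rewrite ?mulf_neq0 ?denq_eq0 // !rmorphM /= ?(numqE u) ?(numqE r) ?(numqE s) ?(numqE t);
  by move: (denq _)%:~R => *; ring.
Qed.

Definition quartic_twist (D : rat) : weierstrass rat := Weierstrass 0 0 0 (- D) 0.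

Lemma disc_integral_model (D : int) (W : weierstrass int) :
  D != 0 -> integral_model (quartic_twist D%:~R) W -> disc W != 0.
Proof.
move=> D0 [u [r [s [t [u0 []]]]]] /=.
case: W => w1 w2 w3 w4 w6 /=.
rewrite ?(mulr0, mul0r, addr0, add0r, subr0, sub0r) => e1 e2 e3 e4 e6.
suff : u ^+ 12 * (disc (Weierstrass w1 w2 w3 w4 w6))%:~R = 64 * D%:~R ^+ 3 :> rat.
  move: (disc _) => w e; apply/eqP=> w0; move: e; rewrite w0 mulr0 => /esym/eqP.
  have D0' : D%:~R != 0 :> rat by rewrite intr_eq0.
  by apply/negP; apply: (mulf_neq0 _ (expf_neq0 3 D0')); rewrite pnatr_eq0.
have -> : u ^+ 12 * (disc (Weierstrass w1 w2 w3 w4 w6))%:~R =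
  disc (Weierstrass (u * w1%:~R) (u ^+ 2 * w2%:~R) (u ^+ 3 * w3%:~R) (u ^+ 4 * w4%:~R)
    (u ^+ 6 * w6%:~R)).
  by rewrite /disc /=; ring.
by rewrite e1 e2 e3 e4 e6 /disc /=; ring.
Qed.

Lemma card_integral_model (p : nat) (D : int) (W : weierstrass int) (u r s t : 'F_p) :
  u != 0 ->
  change_vars u r s t (Weierstrass 0 0 0 (- D%:~R) 0)
    (map_weierstrass (fun n : int => n%:~R : 'F_p) W) ->
  #|[pred xy : 'F_p * 'F_p | on_curve (map_weierstrass (fun n : int => n%:~R) W) xy.1 xy.2]| =
  #|[pred xy : 'F_p * 'F_p | xy.2 ^+ 2 == xy.1 ^+ 3 - D%:~R * xy.1]|.
Proof.
case: W => w1 w2 w3 w4 w6 u0 [] /=.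
rewrite ?(mulr0, mul0r, addr0, add0r, subr0, sub0r) => e1 e2 e3 e4 e6.
pose phi (xy : 'F_p * 'F_p) :=
  (u ^+ 2 * xy.1 + r, u ^+ 3 * xy.2 + s * u ^+ 2 * xy.1 + t).
have phi_inj : injective phi.
  move=> [x y] [x' y'] h.
  have ex : u ^+ 2 * x + r = u ^+ 2 * x' + r := congr1 fst h.
  have ey : u ^+ 3 * y + s * u ^+ 2 * x + t = u ^+ 3 * y' + s * u ^+ 2 * x' + t := congr1 snd h.
  have xx := mulfI (expf_neq0 2 u0) (addIr _ ex).
  rewrite xx in ey *; congr pair.
  exact: mulfI (expf_neq0 3 u0) _ _ (addIr _ (addIr _ ey)).
rewrite -!sum1_card [RHS](reindex_inj phi_inj) /=; apply: eq_bigl => -[x y].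
rewrite !inE /on_curve /= -[RHS]subr_eq0 -[LHS]subr_eq0.
rewrite -[LHS](mulrI_eq0 _ (mulfI (expf_neq0 6 u0))); congr (_ == 0).
transitivity (u ^+ 6 * y ^+ 2 + (u * w1%:~R) * u ^+ 5 * x * y + (u ^+ 3 * w3%:~R) * u ^+ 3 * y
  - (u ^+ 6 * x ^+ 3 + (u ^+ 2 * w2%:~R) * u ^+ 4 * x ^+ 2 + (u ^+ 4 * w4%:~R) * u ^+ 2 * x
     + u ^+ 6 * w6%:~R)); first by ring.
by rewrite e1 e2 e3 e4 e6; ring.
Qed.

(** The rational change of variables is unknown, but clearing denominators turns it into integer
    identities, which reduce modulo any p not dividing d. *)
Lemma integral_model_Fp (p : nat) (p_pr : prime p) (D : int) (W : weierstrass int)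
  (d U V S T : int) (u r s t : rat) :
  d != 0 -> u * d%:~R = U%:~R -> r * d%:~R = V%:~R -> s * d%:~R = S%:~R -> t * d%:~R = T%:~R ->
  change_vars u r s t (quartic_twist D%:~R) (map_weierstrass intr W) ->
  ~~ (p%:Z %| d)%Z ->
  change_vars (U%:~R / d%:~R) (V%:~R / d%:~R) (S%:~R / d%:~R) (T%:~R / d%:~R)
   (Weierstrass 0 0 0 (- D%:~R) 0) (map_weierstrass (fun n : int => n%:~R : 'F_p) W).
Proof.
case: W => w1 w2 w3 w4 w6 d0 uE rE sE tE [] /=.
rewrite ?(mulr0, mul0r, addr0, add0r, subr0, sub0r) => e1 e2 e3 e4 e6.
rewrite (dvdz_pcharf (pchar_Fp p_pr)); set d' := d%:~R => d'0.
have f1 : U * w1 = 2 * S.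
  by apply: (@intr_inj rat); rewrite !rmorphM /= -uE -sE mulrAC e1; ring.
have f2 : U ^+ 2 * w2 = 3 * V * d - S ^+ 2.
  apply: (@intr_inj rat); transitivity ((u ^+ 2 * w2%:~R) * d%:~R ^+ 2 : rat).
    by rewrite rmorphM rmorphXn /= -uE; ring.
  rewrite e2; transitivity (3 * (r * d%:~R) * d%:~R - (s * d%:~R) ^+ 2 : rat); first by ring.
  by rewrite rE sE; ring.
have f3 : U ^+ 3 * w3 = 2 * T * d ^+ 2.
  apply: (@intr_inj rat); transitivity ((u ^+ 3 * w3%:~R) * d%:~R ^+ 3 : rat).
    by rewrite rmorphM rmorphXn /= -uE; ring.
  rewrite e3; transitivity (2 * (t * d%:~R) * d%:~R ^+ 2 : rat); first by ring.
  by rewrite tE; ring.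
have f4 : U ^+ 4 * w4 = - D * d ^+ 4 + 3 * V ^+ 2 * d ^+ 2 - 2 * S * T * d ^+ 2.
  apply: (@intr_inj rat); transitivity ((u ^+ 4 * w4%:~R) * d%:~R ^+ 4 : rat).
    by rewrite rmorphM rmorphXn /= -uE; ring.
  rewrite e4; transitivity (- D%:~R * d%:~R ^+ 4 + 3 * (r * d%:~R) ^+ 2 * d%:~R ^+ 2
    - 2 * (s * d%:~R) * (t * d%:~R) * d%:~R ^+ 2 : rat); first by ring.
  by rewrite rE sE tE; ring.
have f6 : U ^+ 6 * w6 = - V * D * d ^+ 5 + V ^+ 3 * d ^+ 3 - T ^+ 2 * d ^+ 4.
  apply: (@intr_inj rat); transitivity ((u ^+ 6 * w6%:~R) * d%:~R ^+ 6 : rat).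
    by rewrite rmorphM rmorphXn /= -uE; ring.
  rewrite e6; transitivity (- (r * d%:~R) * D%:~R * d%:~R ^+ 5 + (r * d%:~R) ^+ 3 * d%:~R ^+ 3
    - (t * d%:~R) ^+ 2 * d%:~R ^+ 4 : rat); first by ring.
  by rewrite rE tE; ring.
have red a b : a = b -> a%:~R = b%:~R :> 'F_p by move->.
split=> /=; rewrite ?(mulr0, mul0r, addr0, add0r, subr0, sub0r).
- have := red _ _ f1; rewrite !rmorphM /= mulrAC => ->; ring.
- apply: (mulIf (expf_neq0 2 d'0)); have := red _ _ f2.
  rewrite !(rmorphM, rmorphB, rmorphXn) /= -/d' => h.
  transitivity (U%:~R ^+ 2 * w2%:~R : 'F_p); first by field.
  by rewrite h; field.
- apply: (mulIf (expf_neq0 3 d'0)); have := red _ _ f3.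
  rewrite !(rmorphM, rmorphB, rmorphXn) /= -/d' => h.
  transitivity (U%:~R ^+ 3 * w3%:~R : 'F_p); first by field.
  by rewrite h; field.
- apply: (mulIf (expf_neq0 4 d'0)); have := red _ _ f4.
  rewrite !(rmorphM, rmorphD, rmorphB, rmorphN, rmorphXn) /= -/d' => h.
  transitivity (U%:~R ^+ 4 * w4%:~R : 'F_p); first by field.
  by rewrite h; field.
- apply: (mulIf (expf_neq0 6 d'0)); have := red _ _ f6.
  rewrite !(rmorphM, rmorphD, rmorphB, rmorphN, rmorphXn) /= -/d' => h.
  transitivity (U%:~R ^+ 6 * w6%:~R : 'F_p); first by field.
  by rewrite h; field.
Qed.

Lemma minimal_model_reduction (D : int) : D != 0 ->
  exists B : nat, forall p, prime p -> (B < p)%N ->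
    good_reduction (quartic_twist D%:~R) p /\
    frobenius_trace (quartic_twist D%:~R) p = - cubic_sum (D%:~R : 'F_p).
Proof.
move=> D0; have [WE _] := minimal_modelP (quartic_twist D%:~R).
have dW := disc_integral_model D0 WE.
case: WE => u [r [s [t [u0 cv]]]].
have [d [U [V [S [T [d0 uE rE sE tE]]]]]] := common_denominator u r s t.
have U0 : U != 0.
  by rewrite -(intr_eq0 rat) -uE mulf_neq0 // intr_eq0.
have ndvd (n : int) p : n != 0 -> (`|n| < p)%N -> ~~ (p%:Z %| n)%Z.
  move=> n0 np; rewrite dvdzE; apply/negP=> /dvdn_leq.
  by rewrite absz_gt0 n0 leqNgt np => /(_ isT).
(* Beyond this bound p divides neither the discriminant, nor the common denominator d, nor U = ud;
   the 2 makes p odd. *)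
exists (`|disc (minimal_model (quartic_twist D%:~R))| + `|d| + `|U| + 2)%N => p p_pr Bp.
have p_odd : odd p by case/even_prime: p_pr Bp => [->|//]; rewrite addn2.
move/(leq_ltn_trans (leq_addr _ _)): Bp => Bp.
have Bp1 : (`|disc (minimal_model (quartic_twist D%:~R))| < p)%N.
  by apply: leq_ltn_trans Bp; rewrite -addnA leq_addr.
have Bp2 : (`|d| < p)%N by apply: leq_ltn_trans Bp; rewrite addnAC leq_addl.
have Bp3 : (`|U| < p)%N by apply: leq_ltn_trans Bp; rewrite leq_addl.
split; first by have := ndvd _ _ dW Bp1; rewrite dvdzE.
have pd := ndvd _ _ d0 Bp2; have pU := ndvd _ _ U0 Bp3.
have U0' : U%:~R / d%:~R != 0 :> 'F_p.
  by rewrite mulf_neq0 ?invr_eq0 // -(dvdz_pcharf (pchar_Fp p_pr)).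
rewrite /frobenius_trace /card_reduction.
rewrite (card_integral_model U0' (integral_model_Fp p_pr d0 uE rE sE tE cv pd)).
by rewrite -addn1 PoszD (card_cubic p_pr p_odd); ring.
Qed.

(** Up to sign the trace is 2 [jre] or 2 [jim], according to the parity of the logarithm of d. As
    [jim] is even and A odd, A is [jre] up to sign, and m is half of [jim]. *)
Lemma cubic_trace_representation (p : nat) (p_pr : prime p) (p_odd : odd p) (A : int) (d : 'F_p) :
  ~~ (2 %| A)%Z -> d != 0 -> - cubic_sum d = 2 * A ->
  exists m : nat, (0 < m)%N /\ p%:Z = A ^+ 2 + 4 * m%:Z ^+ 2.
Proof.
move=> oA d0 dA; have p4 : (p %% 4)%N = 1%N.
  have [//|p3] : (p %% 4 = 1 \/ p %% 4 = 3)%N by clear -p_odd; lia.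
  by move: dA oA; rewrite cubic_sum3 //; clear; lia.
have N10 : -1 != 0 :> 'F_p by rewrite oppr_eq0 oner_neq0.
have [f f2] : exists f : 'F_p, f ^+ 2 = -1.
  apply/(Euler_criterion p_pr p_odd N10); have := legN1 p_pr p4.
  by rewrite /leg (negPf N10); case: ifP.
suff [m pm] : exists m : int, p%:Z = A ^+ 2 + 4 * m ^+ 2.
  have [_ _ pm0 _] := root_of_representation p_pr pm oA.
  exists `|m|%N; rewrite absz_gt0 pm abszE real_normK ?num_real //; split=> //.
  by apply: contraNneq pm0 => ->; rewrite dvdz0.
have /dvdzP[m b2] := jim_even p_pr p4 f2.
exists m; rewrite -(jac_norm p_pr p4 f2) b2 [RHS](_ : _ = A ^+ 2 + (m * 2) ^+ 2); last by ring.
congr (_ + _); move: dA; rewrite (cubic_sumE p_pr p4 f2 d0) b2 (leg_qlog p_pr p4 f2 d0).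
rewrite /qre /qim (negPf d0); have := qlog_lt4 f d; move: oA; clear.
case: (qlog f d) => [|[|[|[|//]]]] oA _ /= h.
- by have -> : A = - jre f by [lia|]; rewrite sqrrN.
- by exfalso; lia.
- by have -> : A = jre f by lia.
- by exfalso; lia.
Qed.

Lemma trace_iff (A g : int) : ~~ (2 %| A)%Z -> ~~ (2 %| g)%Z ->
  exists (c : int) (G : int -> int) (B : nat), [/\ ~~ (2 %| c)%Z,
    forall m m' : int, (m = m' %[mod g])%Z -> G m = G m' &
    forall p : nat, prime p -> (B < p)%N ->
      (good_reduction (quartic_twist (2 * g)%:~R) p /\
        frobenius_trace (quartic_twist (2 * g)%:~R) p = 2 * A) <->
      exists m : nat, [/\ (0 < m)%N, p%:Z = A ^+ 2 + 4 * m%:Z ^+ 2 &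
         (c * m%:Z + G m%:Z = A - 1 %[mod 4])%Z]].
Proof.
move=> oA og; have [c [G [oc Gp H]]] := cubic_trace_criterion oA og.
have g2 : 2 * g != 0 by move: og; clear; lia.
have [B HB] := minimal_model_reduction g2.
exists c, G, (B + absz (2 * g)%R)%N; split=> // p p_pr Bp.
have [|good tr] := HB p p_pr; first by apply: leq_ltn_trans Bp; rewrite leq_addr.
have pg2 : ~~ (p%:Z %| 2 * g)%Z.
  rewrite dvdzE; apply/negP=> /dvdn_leq; rewrite absz_gt0 g2 => /(_ isT).
  by rewrite leqNgt (leq_ltn_trans _ Bp) ?leq_addl.
have pg : ~~ (p%:Z %| g)%Z by apply: contra pg2; apply: dvdz_mull.
have p_odd : odd p.
  by case/even_prime: p_pr pg2 => [-> |//]; rewrite dvdz_mulr.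
have d0 : (2 * g)%:~R != 0 :> 'F_p by rewrite -(dvdz_pcharf (pchar_Fp p_pr)).
rewrite tr; split=> [[_ e]|[m [m0 pE /(H m p p_pr pE pg)]] //].
have [m [m0 pE]] := cubic_trace_representation p_pr p_odd oA d0 e.
by exists m; split=> //; apply/(H m p p_pr pE pg).
Qed.

(** An odd u is its own inverse modulo 4, so the solution is uw. *)
Lemma odd_linear_mod4 (u w : int) : ~~ (2 %| u)%Z ->
  exists t0 : 'I_4, forall t : 'I_4, (u * t%:Z = w %[mod 4])%Z <-> t = t0.
Proof.
move=> ou.
have [u' [u4 uE]] : exists u' : int, (u = u' %[mod 4])%Z /\ (u' = 1 \/ u' = -1).
  have [h|h] : (u %% 4)%Z = 1 \/ (u %% 4)%Z = 3 by clear -ou; lia.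
    by exists 1; rewrite h; split; [|left].
  by exists (-1); rewrite h; split; [|right].
have r4 : (`|(u' * w) %% 4|%Z < 4)%N by clear; lia.
exists (Ordinal r4) => t; rewrite -modzMml u4 modzMml; split=> [h|->] /=.
  by apply: val_inj => /=; have := ltn_ord t; case: uE h => -> h; lia.
by case: uE => ->; lia.
Qed.

(** * Residue classes of m *)

Section ResidueClasses.
Variables (n : nat) (A : int).
Hypotheses (n_gt0 : (0 < n)%N).

Definition form_values (a b c : int) (p : nat) : Prop :=
  exists k : int, 1 <= k /\ p%:Z = a * k ^+ 2 + b * k + c.

(* [p = 4 m^2 + A^2] with [m = 4 n k + (j + n t)]: the class of [m] is [j]
   modulo [n], and [t] tells apart its four lifts modulo [4 n]. *)
Definition class_values (j t : nat) : nat -> Prop :=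
  form_values (64 * n%:Z ^+ 2) (32 * n%:Z * (j + n * t)%N%:Z) (4 * (j + n * t)%N%:Z ^+ 2 + A ^+ 2).

Lemma class_valuesE (j t p : nat) : class_values j t p <->
  exists k : nat, (0 < k)%N /\ p%:Z = 4 * (4 * n * k + (j + n * t))%N%:Z ^+ 2 + A ^+ 2.
Proof.
rewrite /class_values /form_values; split=> [[k [k1 ->]]|[k [k0 ->]]].
  case: k k1 => [k|//] k1; exists k; split=> //.
  by rewrite !PoszD !PoszM; ring.
by exists k%:Z; split=> //; rewrite !PoszD !PoszM; ring.
Qed.

Lemma represented_class (p m j t : nat) : p%:Z = A ^+ 2 + 4 * m%:Z ^+ 2 -> (4 * n <= m)%N ->
  (j < n)%N -> (t < 4)%N ->
  class_values j t p <-> (m %% n = j /\ (m %/ n) %% 4 = t)%N.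
Proof.
move=> pE mn jn t4; rewrite class_valuesE; split=> [[k [k0]]|[jE tE]].
  rewrite pE addrC => /addIr /(mulfI (_ : 4 != 0 :> int)) -/(_ isT) /eqP.
  rewrite eqf_sqr => /orP[/eqP[mE]|/eqP mE]; last by exfalso; move: mE mn n_gt0; clear -k0; nia.
  have -> : m = ((4 * k + t) * n + j)%N by rewrite mE; ring.
  by rewrite modnMDl divnMDl // divn_small // addn0 modn_small // mulnC modnMDl modn_small.
(* Positive because m >= 4n; the forms in (HL) take only k >= 1. *)
exists (m %/ n %/ 4)%N; split; first by rewrite divn_gt0 // leq_divRL.
rewrite pE addrC; congr (4 * _%:Z ^+ 2 + _).
rewrite {1}(divn_eq m n) {1}(divn_eq (m %/ n) 4) jE tE; ring.
Qed.

Lemma form_values_sq (p : nat) : form_values 4 0 (A ^+ 2) p <->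
  exists m : nat, (0 < m)%N /\ p%:Z = A ^+ 2 + 4 * m%:Z ^+ 2.
Proof.
rewrite /form_values; split=> [[k [k1 ->]]|[m [m0 ->]]].
  by case: k k1 => [k|//] k1; exists k; split=> //; ring.
by exists m%:Z; split=> //; ring.
Qed.

(** For odd A and n, the gcd hypothesis of (HL) on the class polynomial. In the other classes every
    value shares a factor with n, so no large prime occurs. *)
Definition coprime_class (j : nat) : bool := coprimez n%:Z (4 * j%:Z ^+ 2 + A ^+ 2).

(** p > n makes p prime to n, and the other term forces m >= 4n when p = A^2 + 4 m^2. *)
Definition large_prime (p : nat) : bool :=
  prime p && (n + absz (A ^+ 2 + 4 * (4 * n)%N%:Z ^+ 2)%R < p)%N.

Lemma large_represented (p m : nat) : large_prime p -> p%:Z = A ^+ 2 + 4 * m%:Z ^+ 2 ->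
  (4 * n <= m)%N /\ coprime_class (m %% n).
Proof.
move=> /andP[p_pr pn] pE; split.
  rewrite leqNgt; apply/negP=> mn; have : (m%:Z ^+ 2 <= (4 * n)%N%:Z ^+ 2).
    by rewrite ler_sqr ?nnegrE // lez_nat ltnW.
  by have := sqr_ge0 A; move: pn pE; move: (A ^+ 2) (m%:Z ^+ 2) (_ ^+ 2); clear; lia.
have : coprimez n%:Z p%:Z.
  rewrite coprimezE coprime_sym prime_coprime // gtnNdvd //.
  by apply: leq_ltn_trans pn; rewrite leq_addr.
have -> : p%:Z = 4 * ((m %/ n)%N%:Z ^+ 2 * n%:Z + 2 * (m %/ n)%N%:Z * (m %% n)%N%:Z) * n%:Z +
    (4 * (m %% n)%N%:Z ^+ 2 + A ^+ 2).
  rewrite pE; have -> : m%:Z = (m %/ n)%N%:Z * n%:Z + (m %% n)%N%:Z.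
    by rewrite {1}(divn_eq m n) PoszD PoszM.
  by ring.
by rewrite /coprimez gcdzMDl.
Qed.

(** A prime determines its positive m, hence a single pair (j, t), so the indicators add up
    exactly. *)
Lemma class_sum (p : nat) : large_prime p ->
  (`[< form_values 4 0 (A ^+ 2) p >] : nat) =
  (\sum_(j < n | coprime_class j) \sum_(t < 4) `[< class_values j t p >])%N.
Proof.
move=> pl; have [T|T] := asboolP (form_values 4 0 (A ^+ 2) p); last first.
  rewrite big1 // => j _; rewrite big1 // => t _; case: asboolP => // /class_valuesE[k [k0 pE]].
  exfalso; apply: T; apply/form_values_sq; exists (4 * n * k + (j + n * t))%N.
  by rewrite addn_gt0 !muln_gt0 n_gt0 k0 addrC.
have [m [m0 pE]] := (form_values_sq p).1 T.
have [mn mc] := large_represented pl pE.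
have tl : ((m %/ n) %% 4 < 4)%N by rewrite ltn_mod.
have jl : (m %% n < n)%N by rewrite ltn_mod.
rewrite (bigD1 (Ordinal jl)) //= (bigD1 (Ordinal tl)) //=.
rewrite (_ : `[< _ >] = true); last by apply/asboolP/(represented_class pE mn).
rewrite big1 => [|t tt]; last first.
  case: asboolP => // /(represented_class pE mn jl (ltn_ord t))[_ e].
  by case/eqP: tt; apply: val_inj.
rewrite big1 ?addn0 // => j /andP[_ jj]; rewrite big1 // => t _.
case: asboolP => // /(represented_class pE mn (ltn_ord j) (ltn_ord t))[e _].
by case/eqP: jj; apply: val_inj.
Qed.

Lemma selected_class_sum (tau : nat -> nat) (P : nat -> Prop) (p : nat) :
  (forall j, (tau j < 4)%N) -> large_prime p ->
  P p <-> (exists m : nat, [/\ (0 < m)%N, p%:Z = A ^+ 2 + 4 * m%:Z ^+ 2 &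
             ((m %/ n) %% 4 = tau (m %% n))%N]) ->
  (`[< P p >] : nat) = (\sum_(j < n | coprime_class j) `[< class_values j (tau j) p >])%N.
Proof.
move=> tau4 pl Pp; have [T|T] := asboolP (P p); last first.
  rewrite big1 // => j _; case: asboolP => // /[dup] Q /class_valuesE[k [k0 pE]].
  exfalso; apply: T; apply/Pp; exists (4 * n * k + (j + n * tau j))%N.
  have pE' : p%:Z = A ^+ 2 + 4 * (4 * n * k + (j + n * tau j))%N%:Z ^+ 2 by rewrite addrC.
  have [mn _] := large_represented pl pE'.
  have [e1 e2] := (represented_class pE' mn (ltn_ord j) (tau4 j)).1 Q.
  by rewrite e1 e2 addn_gt0 !muln_gt0 n_gt0 k0.
have [m [m0 pE mt]] := Pp.1 T.
have [mn mc] := large_represented pl pE.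
have jl : (m %% n < n)%N by rewrite ltn_mod.
rewrite (bigD1 (Ordinal jl)) //=.
rewrite (_ : `[< _ >] = true); last by apply/asboolP/(represented_class pE mn).
rewrite big1 // => j /andP[_ jj].
case: asboolP => // /(represented_class pE mn (ltn_ord j) (tau4 j))[e _].
by case/eqP: jj; apply: val_inj.
Qed.

End ResidueClasses.

(** * The constants of (HL) *)

Lemma odd_part_odd (k : nat) : odd k -> odd_part k = k.
Proof.
by rewrite odd_2'nat => ok; apply: part_pnat_id.
Qed.

Lemma odd_part_expn2M (e k : nat) : odd k -> odd_part (2 ^ e * k) = k.
Proof.
move=> ok; have k0 : (0 < k)%N by case: k ok.
rewrite /odd_part partnM ?expn_gt0 // -/(odd_part k) odd_part_odd //.
by rewrite partnX (part_p'nat (n := 2)) ?exp1n ?mul1n // pnatNK pnat_id.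
Qed.

(** Both entries share 32n, and the remaining gcd(2n, k) has odd part gcd(n, k); so this factor of
    the constant sees only k modulo n. *)
Lemma odd_part_class_gcd (n k : nat) : odd n ->
  odd_part (gcdn (64 * n ^ 2) (32 * n * k)) = (n * gcdn n k)%N.
Proof.
move=> on; have -> : gcdn (64 * n ^ 2) (32 * n * k) = (32 * n * gcdn (2 * n) k)%N.
  by rewrite muln_gcdr; congr gcdn; ring.
have og a : odd (gcdn n a) by apply: dvdn_odd on; apply: dvdn_gcdl.
have odM a : odd (n * gcdn n a) by rewrite oddM on og.
have [ok|ek] := boolP (odd k).
  rewrite [gcdn (2 * n) k]gcdnC Gauss_gcdr ?coprimen2 // [gcdn k n]gcdnC.
  by rewrite -(odd_part_expn2M 5 (odM k)); congr odd_part; ring.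
have kE : k = (2 * k./2)%N by rewrite mul2n -[LHS]odd_double_half (negPf ek).
rewrite [in LHS]kE -muln_gcdr [in RHS]kE Gauss_gcdr ?coprimen2 //.
by rewrite -(odd_part_expn2M 6 (odM k./2)); congr odd_part; ring.
Qed.

Section Constants.
Variables (R : realType) (n : nat) (A : int).
Hypotheses (on : odd n) (oA : ~~ (2 %| A)%Z).

(** k cancels from the discriminant, which is -256 n^2 A^2, and otherwise enters only through gcd(n,
    k). *)
Lemma HL_const_class (k k' : nat) : k = k' %[mod n] ->
  HL_const R (64 * n%:Z ^+ 2) (32 * n%:Z * k%:Z) (4 * k%:Z ^+ 2 + A ^+ 2) =
  HL_const R (64 * n%:Z ^+ 2) (32 * n%:Z * k'%:Z) (4 * k'%:Z ^+ 2 + A ^+ 2).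
Proof.
move=> kk'; rewrite /HL_const.
have gcd2 (l : nat) : gcdz 2 (64 * n%:Z ^+ 2 + 32 * n%:Z * l%:Z) = 2.
  have -> : 64 * n%:Z ^+ 2 + 32 * n%:Z * l%:Z = (32 * n%:Z ^+ 2 + 16 * n%:Z * l%:Z) * 2 by ring.
  by rewrite -[X in gcdz _ X]addr0 gcdzMDl gcdz0.
have odp (l : nat) : odd_part `|gcdz (64 * n%:Z ^+ 2) (32 * n%:Z * l%:Z)| = (n * gcdn n l)%N.
  by rewrite /gcdz absz_nat !abszM; apply: odd_part_class_gcd.
have gk : gcdn n k = gcdn n k' by rewrite -gcdn_modr kk' gcdn_modr.
have dE (l : nat) : (32 * n%:Z * l%:Z) ^+ 2 - 4 * (64 * n%:Z ^+ 2) * (4 * l%:Z ^+ 2 + A ^+ 2) =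
  - 256 * n%:Z ^+ 2 * A ^+ 2 by ring.
by rewrite !gcd2 !odp gk !dE.
Qed.

Lemma HL_class (k : nat) : hardy_littlewood R -> coprime_class n A k ->
  equiv_pinfty (fun x : R => (quadratic_count (64 * n%:Z ^+ 2) (32 * n%:Z * k%:Z)
                                (4 * k%:Z ^+ 2 + A ^+ 2) x)%:R)
    (fun x => HL_const R (64 * n%:Z ^+ 2) (32 * n%:Z * k%:Z) (4 * k%:Z ^+ 2 + A ^+ 2)
              * (Num.sqrt x / ln x)).
Proof.
move=> HL ck; have n0 : (0 < n)%N by case: n on.
have nz : n%:Z != 0 by rewrite eqz_nat -lt0n.
have A0 : A != 0 by apply: contraNneq oA => ->.
apply: HL.
- by rewrite mulr_gt0 // exprn_gt0 // ltz_nat.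
- move=> [l /eqP]; apply/negP; rewrite neq_lt; apply/orP; left.
  apply: lt_le_trans (sqr_ge0 l).
  rewrite [ltLHS](_ : _ = - (16 * (n%:Z * A)) ^+ 2); last by ring.
  by rewrite oppr_lt0 exprn_even_gt0 // !mulf_neq0.
- apply/eqP; rewrite -/(coprimez _ _) coprimezE.
  apply: (@coprime_dvdl _ (64 * n ^ 2)).
    by rewrite /gcdz absz_nat !abszM; apply: dvdn_gcdl.
  rewrite coprimeMl (_ : 64 = 2 ^ 6)%N // !coprime_pexpl //; apply/andP; split; last first.
    by move: ck; rewrite /coprime_class coprimezE.
  rewrite coprime2n; have [l Al] : exists l, A = 2 * l + 1.
    by exists (divz A 2); clear -oA; lia.
  have -> : 4 * k%:Z ^+ 2 + A ^+ 2 = 2 * (2 * (k%:Z ^+ 2 + l ^+ 2 + l)) + 1 by rewrite Al; ring.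
  by move: (2 * (_ + _ + _)); clear; lia.
- rewrite negb_and; apply/orP; right.
  have [l ->] : exists l, A = 2 * l + 1 by exists (divz A 2); clear -oA; lia.
  have -> : 4 * k%:Z ^+ 2 + (2 * l + 1) ^+ 2 = 2 * (2 * (k%:Z ^+ 2 + l ^+ 2 + l)) + 1 by ring.
  by move: (2 * (_ + _ + _)); clear; lia.
Qed.

Lemma HL_squares : hardy_littlewood R ->
  equiv_pinfty (fun x : R => (quadratic_count 4 0 (A ^+ 2) x)%:R)
    (fun x => HL_const R 4 0 (A ^+ 2) * (Num.sqrt x / ln x)).
Proof.
move=> HL; have A0 : A != 0 by apply: contraNneq oA => ->.
have [l Al] : exists l, A = 2 * l + 1 by exists (divz A 2); clear -oA; lia.
have A2 : A ^+ 2 = 2 * (2 * (l ^+ 2 + l)) + 1 by rewrite Al; ring.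
have oA2 : ~~ (2 %| A ^+ 2)%Z by rewrite A2; move: (2 * (_ + _)); clear; lia.
apply: HL => //.
- move=> [m /eqP]; apply/negP; rewrite neq_lt; apply/orP; left.
  apply: lt_le_trans (sqr_ge0 m).
  rewrite [ltLHS](_ : _ = - (16 * A ^+ 2)); last by ring.
  by rewrite oppr_lt0 mulr_gt0 // exprn_even_gt0.
- apply/eqP; rewrite -/(coprimez _ _) coprimezE gcdz0.
  apply: (@coprime_dvdl _ (2 ^ 2)) => //.
  by rewrite coprime_pexpl // coprime2n; clear -oA2; lia.
Qed.

Lemma prime_prod_eq (P Q : pred nat) (F G : nat -> R) :
  (forall p, prime p -> (if P p then F p else 1) = (if Q p then G p else 1)) ->
  prime_prod P F = prime_prod Q G.
Proof.
move=> PQ; rewrite /prime_prod; congr (limn _); apply: boolp.funext => N.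
rewrite big_mkcondr [RHS]big_mkcondr /=.
by apply: eq_bigr => p; apply: PQ.
Qed.

Lemma legendre_sqrM (p : nat) (a b : int) : prime p -> ~~ (p%:Z %| a)%Z ->
  legendre R (a ^+ 2 * b) p = legendre R b p.
Proof.
move=> p_pr pa; have a0 : a%:~R != 0 :> 'F_p by rewrite -(dvdz_pcharf (pchar_Fp p_pr)).
have sqE : [exists x : 'F_p, x ^+ 2 == (a ^+ 2 * b)%:~R] = [exists x : 'F_p, x ^+ 2 == b%:~R].
  rewrite rmorphM rmorphXn /=.
  apply/existsP/existsP => -[x /eqP xE]; [exists (x / a%:~R)|exists (a%:~R * x)].
    by rewrite expr_div_n xE mulrAC divff ?mul1r // expf_neq0.
  by rewrite exprMn xE.
rewrite /legendre sqE !(dvdz_pcharf (pchar_Fp p_pr)) rmorphM rmorphXn /=.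
by rewrite mulf_eq0 expf_eq0 /= (negPf a0).
Qed.

Lemma HL_const_squares : HL_const R 4 0 (A ^+ 2) =
  prime_prod (fun p => ~~ (p%:Z %| 2 * A)%Z) (fun p => 1 - legendre R (-1) p / (p%:R - 1)).
Proof.
rewrite /HL_const addr0 gcdz0.
have -> : odd_part `|4| = 1%N by rewrite -[`|4|%N]/(2 ^ 2 * 1)%N odd_part_expn2M.
have -> : Num.sqrt 4%:~R = 2 :> R.
  by rewrite (_ : 4%:~R = 2 ^+ 2 :> R) ?sqrtr_sqr ?normr_nat //; ring.
have -> : gcdz 2 4 = 2 by [].
rewrite (_ : 2%:~R = 2 :> R) // (_ : totient 1 = 1%N) // !divff ?pnatr_eq0 // !mul1r.
apply: prime_prod_eq => p p_pr.
have [->|p2] := eqVneq p 2%N; first by rewrite !dvdz_mulr.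
have odp : odd p by apply: contraNT p2; case/even_prime: p_pr => ->.
have pM2 (a : int) : (p%:Z %| 2 * a)%Z = (p%:Z %| a)%Z.
  by rewrite Gauss_dvdzr // coprimezE coprimen2.
have pM4 (a : int) : (p%:Z %| 4 * a)%Z = (p%:Z %| a)%Z.
  by rewrite Gauss_dvdzr // coprimezE (@coprime_pexpr 2 p 2) // coprimen2.
have p8 : (p%:Z %| 2 * 4)%Z = false.
  by rewrite -[4]mulr1 pM2 pM4 dvdzE dvdn1; apply/negbTE; apply: contraTneq p_pr => /= ->.
rewrite p8 pM2 /=.
have -> : 0 ^+ 2 - 4 * 4 * A ^+ 2 = (4 * A) ^+ 2 * -1 by ring.
have [pA|pA] := boolP (p%:Z %| A)%Z; last first.
  by rewrite legendre_sqrM // pM4.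
by rewrite /legendre dvdz_mulr ?mul0r ?subr0 // expr2 dvdz_mulr // dvdz_mull.
Qed.

End Constants.

(** * Counting functions *)

Section Asymptotics.
Variable R : realType.

Lemma prime_count_sum (P : nat -> Prop) (x : R) :
  prime_count P x = (\sum_(0 <= p < (Num.truncn x).+1) (prime p && `[< P p >]))%N.
Proof.
rewrite /prime_count big_mkord -sum1_card [RHS](eq_bigr (fun p : 'I_ _ =>
  if prime p && `[< P p >] then 1%N else 0%N)); last by move=> p _; case: andb.
by rewrite -big_mkcond.
Qed.

Lemma prime_count_eventually (I : finType) (S : pred I) (P : nat -> Prop)
    (Q : I -> nat -> Prop) (B : nat) :
  (forall p, prime p -> (B < p)%N ->
     (`[< P p >] : nat) = (\sum_(i | S i) `[< Q i p >])%N) ->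
  exists C : R, forall x : R,
    `|(prime_count P x)%:R - \sum_(i | S i) (prime_count (Q i) x)%:R| <= C.
Proof.
move=> PQ.
pose d p : R := (prime p && `[< P p >])%:R - \sum_(i | S i) (prime p && `[< Q i p >])%:R.
exists (\sum_(0 <= p < B.+1) `|d p|) => x; set N := (Num.truncn x).+1.
have -> : (prime_count P x)%:R - \sum_(i | S i) (prime_count (Q i) x)%:R =
    \sum_(0 <= p < N) d p.
  rewrite sumrB prime_count_sum natr_sum; congr (_ - _).
  rewrite exchange_big; apply: eq_bigr => i _.
  by rewrite prime_count_sum natr_sum.
apply: le_trans (ler_norm_sum _ _ _) _.
have d0 p : (B < p)%N -> d p = 0.
  move=> Bp; rewrite /d; have [p_pr|_] /= := boolP (prime p); last by rewrite big1 ?subrr.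
  by rewrite (PQ p p_pr Bp) natr_sum subrr.
have [NB|BN] := leqP N B.+1.
  rewrite [leRHS](big_cat_nat (n := N)) //= lerDl sumr_ge0 // => p _; exact: normr_ge0.
rewrite (big_cat_nat (n := B.+1)) ?(ltnW BN) //= gerDl big_nat_cond.
rewrite big1 // => p /andP[/andP[Bp _] _].
by rewrite d0 ?normr0.
Qed.

Local Notation scale := (fun x : R => Num.sqrt x / ln x).

(** Any power of x below 1/2 would do to make bounded errors negligible; here ln y < y is applied at
    y = x^(1/4). *)
Lemma ln_le_sqrt_sqrt (x : R) : 1 < x -> ln x <= 4 * Num.sqrt (Num.sqrt x).
Proof.
move=> x1; set y := Num.sqrt (Num.sqrt x).
have x0 : 0 < x by apply: lt_trans x1.
have y0 : 0 < y by rewrite !sqrtr_gt0.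
have -> : x = y ^+ 4.
  by rewrite (exprM y 2 2) /y !sqr_sqrtr // ltW // sqrtr_gt0.
rewrite lnXn // -[ln y *+ 4]mulr_natl ler_pM2l // ltW //.
by rewrite ln_sublinear.
Qed.

Lemma bounded_div_scale (f : R -> R) (C : R) : (forall x, `|f x| <= C) ->
  f x / scale x @[x --> +oo%R] --> 0.
Proof.
move=> fC; have C0 : 0 <= C := le_trans (normr_ge0 (f 0)) (fC 0).
apply/cvgr0Pnorm_lt => e e0.
have M0 : 0 <= 4 * C / e by rewrite divr_ge0 ?mulr_ge0 // ltW.
near=> x.
have x1 : 1 < x by near: x; apply: nbhs_pinfty_gt; rewrite num_real.
(* This makes y = x^(1/4) exceed 4C/e, while the quotient is at most 4C/y. *)
have xM : (4 * C / e) ^+ 4 < x by near: x; apply: nbhs_pinfty_gt; rewrite num_real.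
have x0 : 0 < x by apply: lt_trans x1.
have := ln_le_sqrt_sqrt x1; set y := Num.sqrt (Num.sqrt x) => lny.
have y0 : 0 < y by rewrite !sqrtr_gt0.
have y2 : Num.sqrt x = y ^+ 2 by rewrite sqr_sqrtr // sqrtr_ge0.
have xy : x = y ^+ 4 by rewrite (exprM y 2 2) -y2 sqr_sqrtr // ltW.
have yM : 4 * C / e < y by move: xM; rewrite xy ltr_pXn2r // nnegrE ltW.
have lx : 0 < ln x by rewrite ln_gt0.
rewrite normrM (ger0_norm (x := _^-1)); last by rewrite invr_ge0 divr_ge0 ?ltW ?sqrtr_gt0.
rewrite invf_div y2; apply: (@le_lt_trans _ _ (C * (4 * y / y ^+ 2))).
  by rewrite ler_pM // ?divr_ge0 ?ler_pM2r ?invr_gt0 ?exprn_gt0 // ltW // exprn_gt0.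
rewrite ltr_pdivrMr // in yM.
rewrite (_ : C * _ = 4 * C / y); last by field; rewrite gt_eqF.
by rewrite ltr_pdivrMr // [e * y]mulrC.
Unshelve. all: by end_near. Qed.

(** For c = 0 the quotient is identically 0, division by 0 being 0, and cannot tend to 1: this is
    where nonvanishing of the constant comes from. *)
Lemma equiv_pinfty_cvg (f : R -> R) (c : R) :
  equiv_pinfty f (fun x => c * (Num.sqrt x / ln x)) ->
  c != 0 /\ f x / scale x @[x --> +oo%R] --> c.
Proof.
rewrite /equiv_pinfty => h; have c0 : c != 0.
  apply/eqP => c0; move: h; rewrite c0.
  under eq_fun do rewrite mul0r invr0 mulr0.
  move=> /(norm_cvg_unique (cvg_cst (0 : R))) /eqP.
  by rewrite eq_sym oner_eq0.
split=> //; have -> : (fun x => f x / scale x) = (fun x => c * (f x / (c * scale x))).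
  apply: boolp.funext => x; move: (_ / _) (f x) => h' u.
  by rewrite invfM [u * (_ * _)]mulrCA mulVKf.
by rewrite -[X in _ --> X]mulr1; apply: cvgMl_tmp.
Qed.

Lemma cvg_equiv_pinfty (f : R -> R) (c : R) : c != 0 ->
  f x / scale x @[x --> +oo%R] --> c ->
  equiv_pinfty f (fun x => c * (Num.sqrt x / ln x)).
Proof.
move=> c0 h; rewrite /equiv_pinfty.
have -> : (fun x => f x / (c * scale x)) = (fun x => c^-1 * (f x / scale x)).
  by apply: boolp.funext => x; move: (_ / _) (f x) => h' u; rewrite invfM mulrCA.
by rewrite -[X in _ --> X](mulVf c0); apply: cvgMl_tmp.
Qed.

Lemma prime_count_scale_cvg (I : finType) (S : pred I) (P : nat -> Prop)
    (Q : I -> nat -> Prop) (B : nat) (c : I -> R) :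
  (forall p, prime p -> (B < p)%N ->
     (`[< P p >] : nat) = (\sum_(i | S i) `[< Q i p >])%N) ->
  (forall i, S i -> (prime_count (Q i) x)%:R / scale x @[x --> +oo%R] --> c i) ->
  (prime_count P x)%:R / scale x @[x --> +oo%R] --> \sum_(i | S i) c i.
Proof.
move=> /prime_count_eventually[C HC] hQ.
have -> : (fun x : R => (prime_count P x)%:R / scale x) = (fun x =>
    ((prime_count P x)%:R - \sum_(i | S i) (prime_count (Q i) x)%:R) / scale x +
    \sum_(i | S i) ((prime_count (Q i) x)%:R / scale x)).
  by apply: boolp.funext => x; rewrite -mulr_suml -mulrDl subrK.
rewrite -[X in _ --> X]add0r; apply: cvgD; first exact: bounded_div_scale HC.
by apply: (cvg_big (op := +%R)) => //; apply: add_continuous.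
Qed.

End Asymptotics.

(** * Selecting one lift per class and comparing limits *)

Lemma HL_class_cvg (R : realType) (n : nat) (A : int) (j t : nat) :
  odd n -> ~~ (2 %| A)%Z -> hardy_littlewood R -> coprime_class n A j ->
  (prime_count (class_values n A j t) x)%:R / (Num.sqrt x / ln x) @[x --> +oo%R] -->
    HL_const R (64 * n%:Z ^+ 2) (32 * n%:Z * j%:Z) (4 * j%:Z ^+ 2 + A ^+ 2).
Proof.
move=> on oA HL cj.
have jt : (j + n * t = j %[mod n])%N by rewrite addnC mulnC modnMDl.
have cjt : coprime_class n A (j + n * t).
  move: cj; rewrite /coprime_class /coprimez; congr (_ == _).
  rewrite -(gcdzMDl (4 * (2 * j%:Z * t%:Z + n%:Z * t%:Z ^+ 2)) n%:Z).
  by rewrite PoszD PoszM; congr gcdz; ring.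
rewrite -(HL_const_class R A on jt).
by have [_] := equiv_pinfty_cvg (HL_class on oA HL cjt).
Qed.

(** Writing m = n(4k + t) + j turns the left side into cnt + cj + G(j) modulo 4; as cn is odd,
    exactly one t solves the congruence. *)
Lemma lift_selection (n : nat) (c A : int) (G : int -> int) :
  odd n -> ~~ (2 %| c)%Z -> (forall m m' : int, (m = m' %[mod n%:Z])%Z -> G m = G m') ->
  exists tau : nat -> 'I_4, forall m : nat,
    (c * m%:Z + G m%:Z = A - 1 %[mod 4])%Z <-> ((m %/ n) %% 4 = tau (m %% n))%N.
Proof.
move=> on oc Gp; have ocn : ~~ (2 %| c * n%:Z)%Z.
  by rewrite Gauss_dvdzl // coprimezE coprime2n.
have [tau Htau] := boolp.choice (fun j : nat =>
  odd_linear_mod4 (A - 1 - G j%:Z - c * j%:Z) ocn).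
exists tau => m; have ml : ((m %/ n) %% 4 < 4)%N by rewrite ltn_mod.
have -> : G m%:Z = G (m %% n)%N%:Z by apply: Gp; rewrite -modz_nat modz_mod.
have mE : c * m%:Z = c * n%:Z * (m %/ n)%N%:Z + c * (m %% n)%N%:Z.
  by rewrite {1}(divn_eq m n) PoszD PoszM; ring.
have qE : c * n%:Z * (m %/ n)%N%:Z =
    c * n%:Z * (m %/ n %/ 4)%N%:Z * 4 + c * n%:Z * (m %/ n %% 4)%N%:Z.
  by rewrite {1}(divn_eq (m %/ n) 4) PoszD PoszM; ring.
have H := Htau (m %% n)%N (Ordinal ml); rewrite /= in H.
apply: (iff_trans (B := Ordinal ml = tau (m %% n)%N)).
  apply: iff_trans H; rewrite mE qE -addrA addrC addrA.
  move: (c * n%:Z * (m %/ n %/ 4)%N%:Z) (c * n%:Z * (m %/ n %% 4)%N%:Z).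
  by move: (c * (m %% n)%N%:Z) (G _) (A - 1); clear => u v w x y; lia.
by split=> [<-|e] //; apply: val_inj.
Qed.

Lemma trace_count_cvg (R : realType) (A g : int) : ~~ (2 %| A)%Z -> ~~ (2 %| g)%Z ->
  hardy_littlewood R ->
  HL_const R 4 0 (A ^+ 2) != 0 /\
  (trace_count (quartic_twist (2 * g)%:~R) (2 * A) x)%:R / (Num.sqrt x / ln x) @[x --> +oo%R] -->
    (1 / 4 * HL_const R 4 0 (A ^+ 2) : R).
Proof.
move=> oA og HL; set n := `|g|%N.
have on : odd n by rewrite /n; move: og; clear; lia.
have n0 : (0 < n)%N by case: n on.
have [c [G [B [oc Gp HB]]]] := trace_iff oA og.
have [m m' mm'|tau Htau] := @lift_selection n c A G on oc.
  apply: Gp; move/eqP: mm'; rewrite eqz_mod_dvd => mm'.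
  by apply/eqP; rewrite eqz_mod_dvd; move: mm'; rewrite !dvdzE.
pose B' := (B + (n + absz (A ^+ 2 + 4 * (4 * n)%N%:Z ^+ 2)%R))%N.
have large p : prime p -> (B' < p)%N -> large_prime n A p.
  by move=> p_pr Bp; rewrite /large_prime p_pr (leq_ltn_trans _ Bp) ?leq_addl.
pose L (j : nat) := HL_const R (64 * n%:Z ^+ 2) (32 * n%:Z * j%:Z) (4 * j%:Z ^+ 2 + A ^+ 2).
have trace : (trace_count (quartic_twist (2 * g)%:~R) (2 * A) x)%:R / (Num.sqrt x / ln x)
    @[x --> +oo%R] --> \sum_(j < n | coprime_class n A j) L j.
  apply: (@prime_count_scale_cvg R _ _ _ (fun j : 'I_n => class_values n A j (tau j)) B').
    move=> p p_pr Bp.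
    have tau4 j : (tau j < 4)%N by [].
    apply: (@selected_class_sum n A n0 (fun j => tau j) (fun p =>
      good_reduction (quartic_twist (2 * g)%:~R) p /\
      frobenius_trace (quartic_twist (2 * g)%:~R) p = 2 * A) p tau4 (large p p_pr Bp)).
    apply: iff_trans (HB p p_pr (leq_ltn_trans (leq_addr _ _) Bp)) _.
    by split=> -[m [m0 pE /Htau mt]]; exists m.
  by move=> j cj; apply: HL_class_cvg.
have total : (quadratic_count 4 0 (A ^+ 2) x)%:R / (Num.sqrt x / ln x)
    @[x --> +oo%R] --> \sum_(jt : 'I_n * 'I_4 | coprime_class n A jt.1) L jt.1.
  apply: (@prime_count_scale_cvg R ('I_n * 'I_4)%type (fun jt => coprime_class n A jt.1)
    (form_values 4 0 (A ^+ 2)) (fun jt => class_values n A jt.1 jt.2) B' (fun jt => L jt.1)).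
    move=> p p_pr Bp; rewrite (class_sum n0 (large p p_pr Bp)).
    by rewrite pair_big /=; apply: eq_bigl => -[j t]; rewrite andbT.
  by move=> jt cj; apply: HL_class_cvg.
have [C0 total'] := equiv_pinfty_cvg (HL_squares oA HL).
split=> //.
(* Each class carries four equal limits [L j], so uniqueness of the limit for 4 m^2 + A^2 makes its
   constant 4 times the sum over classes. *)
have -> : 1 / 4 * HL_const R 4 0 (A ^+ 2) = \sum_(j < n | coprime_class n A j) L j.
  2: exact: trace.
rewrite (norm_cvg_unique total' total).
rewrite (eq_bigl (fun jt : 'I_n * 'I_4 => coprime_class n A jt.1 && xpredT jt.2));
  last by move=> jt; rewrite andbT.
rewrite -(pair_big (fun j : 'I_n => coprime_class n A j) xpredT (fun j (_ : 'I_4) => L j)) /=.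
under eq_bigr do rewrite sumr_const card_ord.
by rewrite sumrMnl; move: (\sum_(_ | _) _) => s; field.
Qed.

Theorem corollary1p7 (R : realType) (g : int) (hg : ~~ (2 %| g)%Z)
    (r : int) (hr : (r = 2 %[mod 4])%Z) :
  let E := Weierstrass 0 0 0 (- (2 * g)%:~R) 0 : weierstrass rat in
  hardy_littlewood R ->
  equiv_pinfty
    (fun x : R => (trace_count E r x)%:R)
    (fun x : R =>
       1 / 4 * prime_prod (fun p => ~~ (p%:Z %| r)%Z)
                          (fun p => 1 - legendre R (-1) p / (p%:R - 1))
       * (Num.sqrt x / ln x)).
Proof.
move=> E HL; have [A [rE oA]] : exists A : int, r = 2 * A /\ ~~ (2 %| A)%Z.
  by exists (divz r 2); move: hr; clear; lia.
have [C0 traceA] := trace_count_cvg oA hg HL.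
rewrite rE -(HL_const_squares R A); apply: cvg_equiv_pinfty traceA.
by rewrite mulf_neq0 // div1r invr_neq0 // pnatr_eq0.
Qed.
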